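(* Suppose each $f_i$ is convex and differentiable with $(1/\gamma_i)$-Lipschitz continuous gradient and $g$ is $\lambda$-strongly convex, and let $(w^\star,\alpha^\star)$ be the unique saddle point of $L(w,\alpha)$. Let $\Gamma$ be a constant that satisfies $$\Gamma \ge \max_{i,k}\left\{ \frac{1}{p_i}\left(1+\frac{9\|X_{ik}\|^2}{2 q_k \lambda\gamma_i}\right),\ \frac{1}{q_k}\left(1+\frac{9n\|X_{ik}\|^2}{2m p_i\lambda\gamma_i}\right)\right\}.$$ In the DSCOVR-SVRG algorithm (described in the context), if we choose the step sizes as $$\sigma_i = \frac{1}{2\gamma_i(p_i\Gamma-1)},\quad i=1,\ldots,m,\qquad \tau_k = \frac{1}{2\lambda(q_k\Gamma-1)},\quad k=1,\ldots,n,$$ and the number of iterations during each stage satisfies $M\ge \log(3)\,\Gamma$, then for any $s>0$, $$\mathbf{E}\left[\Omega\bigl(\bar w^{(s)}-w^\star,\bar\alpha^{(s)}-\alpha^\star\bigr)\right]\le \left(\frac{2}{3}\right)^s \Omega\bigl(\bar w^{(0)}-w^\star,\bar\alpha^{(0)}-\alpha^\star\bigr).$$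
   Context: Setting. $m,n,N_1,\ldots,N_m,d_1,\ldots,d_n$ are positive integers, $N=\sum_i N_i$, $d=\sum_k d_k$. Vectors $w\in\mathbb{R}^d$ are partitioned as $w=[w_1;\ldots;w_n]$ with $w_k\in\mathbb{R}^{d_k}$, and $\alpha\in\mathbb{R}^N$ as $\alpha=[\alpha_1;\ldots;\alpha_m]$ with $\alpha_i\in\mathbb{R}^{N_i}$. The matrix $X\in\mathbb{R}^{N\times d}$ is partitioned conformally into blocks $X_{ik}\in\mathbb{R}^{N_i\times d_k}$; $X_{i:}\in\mathbb{R}^{N_i\times d}$ denotes the $i$-th block row and $X_{:k}\in\mathbb{R}^{N\times d_k}$ the $k$-th block column. Given are functions $f_i:\mathbb{R}^{N_i}\to\mathbb{R}$ and $g(w)=\sum_{k=1}^n g_k(w_k)$ with $g_k:\mathbb{R}^{d_k}\to\mathbb{R}$, and constants $\lambda>0$, $\gamma_i>0$. $f_i^*(\alpha_i)=\sup_{u}\{\alpha_i^Tu-f_i(u)\}$ is the convex conjugate, and $$L(w,\alpha)=\frac1m\sum_{i=1}^m\alpha_i^TX_{i:}w-\frac1m\sum_{i=1}^m f_i^*(\alpha_i)+g(w).$$ $\lambda$-strong convexity of $g$ means $g(w')\ge g(w)+\xi^T(w'-w)+\frac\lambda2\|w'-w\|^2$ for all $w,w'$ and $\xi\in\partial g(w)$. A saddle point satisfies $L(w^\star,\alpha)\le L(w^\star,\alpha^\star)\le L(w,\alpha^\star)$ for all $(w,\alpha)$; under the stated assumptions on $f_i,g$ it exists and is unique. Norms: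 $\|\cdot\|$ is the Euclidean norm for vectors and the spectral norm for matrices. Define $$\Omega(w,\alpha)=\lambda\|w\|^2+\frac1m\sum_{i=1}^m\gamma_i\|\alpha_i\|^2 .$$ The proximal mapping is $\mathbf{prox}_\phi(v)=\arg\min_u\{\phi(u)+\frac12\|u-v\|^2\}$. $p=(p_1,\ldots,p_m)$ and $q=(q_1,\ldots,q_n)$ are probability distributions with all $p_i,q_k>0$; the step sizes $\sigma_i,\tau_k$ are understood to be positive finite numbers (i.e. $p_i\Gamma>1$, $q_k\Gamma>1$). DSCOVR-SVRG algorithm. Input: deterministic initial points $\bar w^{(0)}\in\mathbb{R}^d$, $\bar\alpha^{(0)}\in\mathbb{R}^N$, and the number $M$ (a positive integer) of iterations per stage. For each stage $s=0,1,2,\ldots$: set $\bar u^{(s)}=X\bar w^{(s)}$ and $\bar v^{(s)}=\frac1mX^T\bar\alpha^{(s)}$ (partitioned like $\alpha$ and $w$), $w^{(0)}=\bar w^{(s)}$, $\alpha^{(0)}=\bar\alpha^{(s)}$. For $t=0,\ldots,M-1$: pick $j\in\{1,\ldots,m\}$ with distribution $p$ and $l\in\{1,\ldots,n\}$ with distribution $q$, independently of each other and of the past; compute $$u_j^{(t+1)}=\bar u_j^{(s)}+\tfrac1{q_l}X_{jl}\bigl(w_l^{(t)}-\bar w_l^{(s)}\bigr),\qquad v_l^{(t+1)}=\bar v_l^{(s)}+\tfrac1{p_j}\tfrac1m X_{jl}^T\bigl(\alpha_j^{(t)}-\bar\alpha_j^{(s)}\bigr);$$ set $\alpha_j^{(t+1)}=\mathbf{prox}_{\sigma_jf_j^*}(\alpha_j^{(t)}+\sigma_ju_j^{(t+1)})$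 and $\alpha_i^{(t+1)}=\alpha_i^{(t)}$ for $i\ne j$; set $w_l^{(t+1)}=\mathbf{prox}_{\tau_lg_l}(w_l^{(t)}-\tau_lv_l^{(t+1)})$ and $w_k^{(t+1)}=w_k^{(t)}$ for $k\ne l$. At the end of the stage set $\bar w^{(s+1)}=w^{(M)}$, $\bar\alpha^{(s+1)}=\alpha^{(M)}$. The expectation $\mathbf{E}$ is over all random indices. *)

(* Defs.v *)
From HB Require Import structures.
From mathcomp Require Export all_boot all_order all_algebra.
From mathcomp Require Export all_classical all_reals all_analysis.
Export Order.TTheory GRing.Theory Num.Theory.
Export numFieldNormedType.Exports.

Set Implicit Arguments.
Unset Strict Implicit.
Unset Printing Implicit Defensive.

Local Open Scope classical_set_scope.
Local Open Scope ring_scope.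

Section Euclidean.
Context {R : realType}.

Definition inner {k : nat} (x y : 'cV[R]_k) : R := (x^T *m y) 0 0.

(* The library norm on matrices is the sup norm. *)
Definition enorm {k : nat} (x : 'cV[R]_k) : R := Num.sqrt (inner x x).

Definition spectral_norm {k l : nat} (A : 'M[R]_(k, l)) : R :=
  sup [set enorm (A *m x) | x in [set x : 'cV[R]_l | enorm x <= 1]].

Definition gradient {k : nat} (f : 'cV[R]_k -> R) (x : 'cV[R]_k) : 'cV[R]_k :=
  \col_i 'D_(delta_mx i 0) f x.

Definition subdifferential {k : nat} (g : 'cV[R]_k -> R) (w : 'cV[R]_k) :
    set 'cV[R]_k :=
  [set xi | forall w', g w + inner xi (w' - w) <= g w'].

(* Convexity is required separately: the subgradient inequality alone is
   vacuous at points where the subdifferential is empty. *)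
Definition strongly_convex {k : nat} (lambda : R) (g : 'cV[R]_k -> R) : Prop :=
  convex_function setT g /\
  forall w w' xi, subdifferential g w xi ->
    g w + inner xi (w' - w) + lambda / 2 * enorm (w' - w) ^+ 2 <= g w'.

Definition conjugate {k : nat} (f : 'cV[R]_k -> R) (a : 'cV[R]_k) : \bar R :=
  ereal_sup [set (inner a u - f u)%:E | u in [set: 'cV[R]_k]].

Definition prox {k : nat} (phi : 'cV[R]_k -> \bar R) (v : 'cV[R]_k) :
    'cV[R]_k :=
  get [set u | forall u',
    (phi u + (2^-1 * enorm (u - v) ^+ 2)%:E <=
     phi u' + (2^-1 * enorm (u' - v) ^+ 2)%:E)%E].

End Euclidean.

Section SaddlePoint.
Context {R : realType} {m n : nat} {N : 'I_m -> nat} {d : 'I_n -> nat}.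
Implicit Types (w : 'cV[R]_(\sum_k d k)) (alpha : 'cV[R]_(\sum_i N i)).

Definition separable_sum (g : forall k, 'cV[R]_(d k) -> R) w : R :=
  \sum_k g k (submxcol w k).

(* Extended-real valued, since the conjugates may take the value +oo. *)
Definition lagrangian (X : 'M[R]_(\sum_i N i, \sum_k d k))
    (f : forall i, 'cV[R]_(N i) -> R) (g : forall k, 'cV[R]_(d k) -> R)
    w alpha : \bar R :=
  ((m%:R^-1 * \sum_i inner (submxcol alpha i) (submxcol X i *m w))%:E
   - (m%:R^-1)%:E * \sum_i conjugate (f i) (submxcol alpha i)
   + (separable_sum g w)%:E)%E.

Definition saddle_point (L : 'cV[R]_(\sum_k d k) -> 'cV[R]_(\sum_i N i) -> \bar R)
    w alpha : Prop :=
  forall w' alpha', (L w alpha' <= L w alpha)%E /\ (L w alpha <= L w' alpha)%E.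

Definition Omega (lambda : R) (gamma : 'I_m -> R) w alpha : R :=
  lambda * enorm w ^+ 2
  + m%:R^-1 * \sum_i gamma i * enorm (submxcol alpha i) ^+ 2.

End SaddlePoint.

Section Algorithm.
Context {R : realType} {m n : nat} {N : 'I_m -> nat} {d : 'I_n -> nat}.
Context (X : 'M[R]_(\sum_i N i, \sum_k d k)).
Context (f : forall i, 'cV[R]_(N i) -> R) (g : forall k, 'cV[R]_(d k) -> R).
Context (p : 'I_m -> R) (q : 'I_n -> R) (sigma : 'I_m -> R) (tau : 'I_n -> R).

Definition iterate : Type := 'cV[R]_(\sum_k d k) * 'cV[R]_(\sum_i N i).

Definition svrg_step (zbar : iterate) (j : 'I_m) (l : 'I_n) (z : iterate) :
    iterate :=
  let: (wbar, abar) := zbar in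
  let: (w, a) := z in
  let ubar := X *m wbar in
  let vbar := m%:R^-1 *: (X^T *m abar) in
  let u i := submxcol ubar i
    + (q l)^-1 *: (submxblock X i l *m (submxcol w l - submxcol wbar l)) in
  let v k := submxcol vbar k
    + ((p j)^-1 * m%:R^-1) *:
        ((submxblock X j k)^T *m (submxcol a j - submxcol abar j)) in
  (\mxcol_k (if k == l then
               prox (fun x => (tau k * g x)%:E)
                    (submxcol w k - tau k *: v k)
             else submxcol w k),
   \mxcol_i (if i == j then
               prox (fun x => ((sigma i)%:E * conjugate (@f i) x)%E)
                    (submxcol a i + sigma i *: u i)
             else submxcol a i)).

Fixpoint svrg_inner (zbar : iterate) (j : nat -> 'I_m) (l : nat -> 'I_n)
    (t : nat) : iterate :=
  if t is t'.+1 then svrg_step zbar (j t') (l t') (svrg_inner zbar j l t')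
  else zbar.

(* The picks are numbered consecutively over all stages: iteration t of stage
   s uses j (s * M + t) and l (s * M + t). *)
Fixpoint dscovr_svrg (M : nat) (z0 : iterate) (j : nat -> 'I_m)
    (l : nat -> 'I_n) (s : nat) : iterate :=
  if s is s'.+1 then
    svrg_inner (dscovr_svrg M z0 j l s')
      (fun t => j (s' * M + t)%N) (fun t => l (s' * M + t)%N) M
  else z0.

End Algorithm.

Section Sampling.
Context {disp : measure_display} {T : measurableType disp} {R : realType}.
Context (P : probability T R).

Definition mutually_independent {I : eqType} (F : I -> set (set T)) : Prop :=
  forall (D : seq I) (A : I -> set T), uniq D ->
    (forall i, i \in D -> F i (A i)) ->
    P (\big[setI/setT]_(i <- D) A i) = (\prod_(i <- D) P (A i))%E.

(* The sigma-algebra generated by a map into a finite type, the latter with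
   all its subsets measurable. *)
Definition generated_events {K : finType} (Z : T -> K) : set (set T) :=
  preimage_set_system setT Z setT.

Definition independent_picks {m n : nat} (p : 'I_m -> R) (q : 'I_n -> R)
    (J : nat -> T -> 'I_m) (L : nat -> T -> 'I_n) : Prop :=
  [/\ forall r, generated_events (J r) `<=` measurable,
      forall r, generated_events (L r) `<=` measurable,
      forall r i, P (J r @^-1` [set i]) = (p i)%:E,
      forall r k, P (L r @^-1` [set k]) = (q k)%:E
    & mutually_independent (fun x : nat + nat =>
        match x with
        | inl r => generated_events (J r)
        | inr r => generated_events (L r)
        end)].

End Sampling.

(* Main.v *)
(* With the strong convexity of [g], and cocoercivity of the gradients of the
   smooth [f i] (through Moreau's decomposition) in place of the strong convexity
   of the conjugates, a proximal update of one block contracts its distance to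
   the saddle point up to an inner product with the error of the stochastic
   direction. The step sizes are such that, averaged over both picks, the weights
   of all blocks become [Gam] times those of [Omega]; the mean errors of the
   primal and dual directions then cancel by skew-symmetry of the coupling, and
   by the choice of [Gam] their second moments cost at most one ninth of
   [Omega z + Omega zbar] (distances to the saddle point). Hence
   [Gam * E (Omega z') <= (Gam - 8/9) * Omega z + 1/9 * Omega zbar], and a stage
   multiplies the expectation by at most
   [7/8 * (1 - 8/9/Gam)^M + 1/8 <= 7/8 * 3^(-1/2) + 1/8 <= 2/3]. *)
From mathcomp Require Import ring lra measurable_realfun.
Require Import Defs.

Set Implicit Arguments.
Unset Strict Implicit.
Unset Printing Implicit Defensive.

Local Open Scope classical_set_scope.
Local Open Scope ring_scope.

(** * Euclidean and spectral norms *)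

Section Inner.
Context {R : realType} {k : nat}.
Implicit Types (x y z : 'cV[R]_k) (a : R).

Lemma innerE x y : inner x y = \sum_i x i 0 * y i 0.
Proof. by rewrite /inner mxE; apply: eq_bigr => i _; rewrite mxE. Qed.

Lemma innerC x y : inner x y = inner y x.
Proof. by rewrite !innerE; apply: eq_bigr => i _; rewrite mulrC. Qed.

Lemma innerDl x y z : inner (x + y) z = inner x z + inner y z.
Proof. by rewrite /inner linearD mulmxDl mxE. Qed.

Lemma innerZl a x y : inner (a *: x) y = a * inner x y.
Proof. by rewrite /inner linearZ -scalemxAl mxE. Qed.

Lemma innerNl x y : inner (- x) y = - inner x y.
Proof. by rewrite -scaleN1r innerZl mulN1r. Qed.

Lemma innerDr x y z : inner z (x + y) = inner z x + inner z y.
Proof. by rewrite innerC innerDl !(innerC z). Qed.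

Lemma innerZr a x y : inner x (a *: y) = a * inner x y.
Proof. by rewrite innerC innerZl innerC. Qed.

Lemma innerNr x y : inner x (- y) = - inner x y.
Proof. by rewrite innerC innerNl innerC. Qed.

Lemma inner0l x : inner 0 x = 0.
Proof. by rewrite -(scale0r 0) innerZl mul0r. Qed.

Lemma inner_suml (I : Type) (r : seq I) (F : I -> 'cV[R]_k) y :
  inner (\sum_(i <- r) F i) y = \sum_(i <- r) inner (F i) y.
Proof.
exact: (big_morph (fun x => inner x y) (fun u v => innerDl u v y) (inner0l y)).
Qed.

Definition inner_linear := (innerDl, innerDr, innerNl, innerNr, innerZl, innerZr).

Lemma inner_ge0 x : 0 <= inner x x.
Proof. by rewrite innerE sumr_ge0// => i _; rewrite -expr2 sqr_ge0. Qed.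

Lemma sqr_enorm x : enorm x ^+ 2 = inner x x.
Proof. by rewrite sqr_sqrtr// inner_ge0. Qed.

Lemma enorm_ge0 x : 0 <= enorm x.
Proof. exact: sqrtr_ge0. Qed.

Lemma inner_eq0 x : (inner x x == 0) = (x == 0).
Proof.
apply/idP/eqP => [|->]; last by rewrite inner0l.
rewrite innerE psumr_eq0 => [/allP x0|i _]; last by rewrite -expr2 sqr_ge0.
apply/colP => i; rewrite mxE; apply/eqP.
by have := x0 i; rewrite mem_index_enum mulf_eq0 orbb; apply.
Qed.

Lemma enormZ a x : enorm (a *: x) = `|a| * enorm x.
Proof.
by rewrite /enorm innerZl innerZr mulrA -expr2 sqrtrM ?sqr_ge0// sqrtr_sqr.
Qed.

Lemma enorm0 : enorm (0 : 'cV[R]_k) = 0.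
Proof. by rewrite -(scale0r 0) enormZ normr0 mul0r. Qed.

(** The squared norm of [inner y y *: x - inner x y *: y] is [inner y y] times the gap between the
    two sides. *)
Lemma CauchySchwarz x y : inner x y ^+ 2 <= inner x x * inner y y.
Proof.
have [->|y0] := eqVneq y 0; first by rewrite innerC !inner0l expr0n mulr0.
have y_gt0 : 0 < inner y y by rewrite lt_neqAle inner_ge0 eq_sym inner_eq0 y0.
have := inner_ge0 (inner y y *: x - inner x y *: y).
rewrite !inner_linear (innerC y x) => H.
rewrite -subr_ge0 -(pmulr_rge0 _ y_gt0).
by apply: le_trans H _; rewrite le_eqVlt; apply/orP; left; apply/eqP; ring.
Qed.

Lemma inner_le_enorm x y : inner x y <= enorm x * enorm y.
Proof.
apply: le_trans (ler_norm _) _; rewrite -sqrtr_sqr -sqrtrM ?inner_ge0//.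
exact/ler_wsqrtr/CauchySchwarz.
Qed.

End Inner.

Section SpectralNorm.
Context {R : realType}.

Lemma inner_mulmx {k l : nat} (A : 'M[R]_(k, l)) x y :
  inner (A *m x) y = inner x (A^T *m y).
Proof. by rewrite /inner trmx_mul -mulmxA. Qed.

(** The Frobenius norm serves as [C]. It bounds the set in [spectral_norm], so that its supremum is
    an actual upper bound. *)
Lemma enorm_mulmx_bounded {k l : nat} (A : 'M[R]_(k, l)) :
  exists2 C, 0 <= C & forall x, enorm (A *m x) <= C * enorm x.
Proof.
exists (Num.sqrt (\sum_i inner (row i A)^T (row i A)^T)); first exact: sqrtr_ge0.
move=> x; rewrite -sqrtrM; last by rewrite sumr_ge0// => i _; exact: inner_ge0.
apply: ler_wsqrtr; rewrite innerE mulr_suml; apply: ler_sum => i _.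
apply: le_trans (CauchySchwarz _ _).
suff -> : (A *m x) i 0 = inner (row i A)^T x by rewrite -expr2.
by rewrite innerE mxE; apply: eq_bigr => j _; rewrite !mxE.
Qed.

Lemma spectral_norm_ge0 {k l : nat} (A : 'M[R]_(k, l)) : 0 <= spectral_norm A.
Proof.
have [C C0 AC] := enorm_mulmx_bounded A.
apply: ub_le_sup; last by exists 0; rewrite /= ?mulmx0 ?enorm0.
by exists C => _ [x /= x1 <-]; rewrite (le_trans (AC x))// ler_piMr.
Qed.

Lemma enorm_mulmx_le {k l : nat} (A : 'M[R]_(k, l)) x :
  enorm (A *m x) <= spectral_norm A * enorm x.
Proof.
have [C C0 AC] := enorm_mulmx_bounded A.
have [x0|x0] := eqVneq (enorm x) 0.
  by rewrite (le_trans (AC x))// x0 !mulr0.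
have x_gt0 : 0 < enorm x by rewrite lt_neqAle eq_sym x0 enorm_ge0.
rewrite -ler_pdivrMr//; apply: ub_le_sup.
  by exists C => _ [y /= y1 <-]; rewrite (le_trans (AC y))// ler_piMr.
exists ((enorm x)^-1 *: x) => /=; rewrite -?scalemxAr enormZ ger0_norm.
- by rewrite mulVf.
- by rewrite invr_ge0 enorm_ge0.
- by rewrite mulrC.
- by rewrite invr_ge0 enorm_ge0.
Qed.

(** The square of [enorm (A^T *m y)] is the inner product of [A *m (A^T *m y)] with [y]; after
    Cauchy-Schwarz and the bound for [A], one factor cancels. *)
Lemma enorm_trmx_mulmx_le {k l : nat} (A : 'M[R]_(k, l)) y :
  enorm (A^T *m y) <= spectral_norm A * enorm y.
Proof.
have [->|y0] := eqVneq (enorm (A^T *m y)) 0.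
  by rewrite mulr_ge0 ?spectral_norm_ge0 ?enorm_ge0.
have y_gt0 : 0 < enorm (A^T *m y) by rewrite lt_neqAle eq_sym y0 enorm_ge0.
rewrite -(ler_pM2r y_gt0) -expr2 sqr_enorm -inner_mulmx.
apply: le_trans (inner_le_enorm _ _) _.
by rewrite mulrAC ler_wpM2r ?enorm_ge0 ?enorm_mulmx_le.
Qed.

End SpectralNorm.

(** * Convex functions and proximal maps *)

Section Convex.
Context {R : realType}.

Lemma convex_functionP {V : lmodType R} (h : V -> R) :
  convex_function setT h <->
  forall x y (t : R), 0 <= t -> t <= 1 ->
    h (t *: x + (1 - t) *: y) <= t * h x + (1 - t) * h y.
Proof.
split=> [ch x y t t0 t1|ch t x y _ _].
  exact: (ch (Itv01 t0 t1) x y (in_setT _) (in_setT _)).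
exact: ch.
Qed.

(** Jensen's inequality with the remaining weight on [u]. The induction splits off [a i] and
    rescales the other weights by the inverse of [1 - a i], positive because the total is below
    1. *)
Lemma convex_shift_sum {V : lmodType R} (h : V -> R) (u : V) (I : Type)
    (r : seq I) (a : I -> R) (e : I -> V) :
  convex_function setT h -> (forall i, 0 <= a i) -> \sum_(i <- r) a i < 1 ->
  h (u + \sum_(i <- r) a i *: e i) - h u
    <= \sum_(i <- r) a i * (h (u + e i) - h u).
Proof.
move=> /convex_functionP ch a0; elim: r a a0 => [|i r IH] a a0.
  by rewrite !big_nil addr0 subrr.
rewrite !big_cons => ar1.
have r0 : 0 <= \sum_(j <- r) a j by exact: sumr_ge0.
have ai1 : 0 < 1 - a i by lra.
have := IH (fun j => (1 - a i)^-1 * a j).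
rewrite -mulr_sumr mulrC ltr_pdivrMr// => /(_ _ _)/wrap[|//|H].
- by move=> j; rewrite mulr_ge0// invr_ge0 ltW.
- lra.
have a1 : a i <= 1 by lra.
have := ch (u + e i) (u + \sum_(j <- r) ((1 - a i)^-1 * a j) *: e j)
  (a i) (a0 i) a1.
have -> : a i *: (u + e i) +
    (1 - a i) *: (u + \sum_(j <- r) ((1 - a i)^-1 * a j) *: e j) =
    u + (a i *: e i + \sum_(j <- r) a j *: e j).
  under eq_bigr do rewrite -scalerA.
  rewrite -scaler_sumr !scalerDr scalerA divff ?gt_eqF// scale1r.
  by rewrite addrACA -scalerDl subrKC scale1r.
move=> H1; move: H; under [leRHS]eq_bigr do rewrite -mulrA.
rewrite -mulr_sumr -(ler_pM2l ai1) mulVKf ?gt_eqF//.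
lra.
Qed.

Lemma coord_le_enorm {k : nat} (x : 'cV[R]_k) i : `|x i 0| <= enorm x.
Proof.
rewrite -sqrtr_sqr; apply: ler_wsqrtr; rewrite innerE (bigD1 i)//= -expr2 lerDl.
by apply: sumr_ge0 => j _; rewrite -expr2 sqr_ge0.
Qed.

(* Bounds [h] above by its values at the vertices of the cross-polytope around
   [u], and below by reflection through [u]. *)
Lemma convex_locally_lipschitz {k : nat} (h : 'cV[R]_k -> R) (u : 'cV[R]_k) :
  convex_function setT h ->
  exists2 B : R, 0 <= B & forall x : 'cV[R]_k, \sum_i `|x i 0| < 1 ->
    `|h (u + x) - h u| <= B * \sum_i `|x i 0|.
Proof.
move=> ch; have /convex_functionP ch' := ch.
pose b (i : 'I_k) : R :=
  `|h (u + delta_mx i 0) - h u| + `|h (u - delta_mx i 0) - h u|.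
pose B : R := \sum_i b i.
have b0 i : 0 <= b i by rewrite addr_ge0.
have bB i : b i <= B by rewrite /B (bigD1 i)//= lerDl sumr_ge0.
have up (x : 'cV[R]_k) : \sum_i `|x i 0| < 1 ->
    h (u + x) - h u <= B * \sum_i `|x i 0|.
  move=> x1.
  (* A combination of signed basis vectors with weights [|x i 0|], ready for Jensen. *)
  have xE : x = \sum_i `|x i 0| *: (Num.sg (x i 0) *: delta_mx i 0).
    apply/colP => j; rewrite summxE (bigD1 j)//= !mxE !eqxx mulr1 mulrC -numEsg.
    rewrite big1 ?addr0// => i ij; rewrite !mxE eq_sym (negbTE ij).
    by rewrite !mulr0.
  rewrite [in h (u + x)]xE; apply: le_trans (convex_shift_sum _ _ ch _ x1) _ => //.
  rewrite mulr_sumr; apply: ler_sum => i _; rewrite mulrC.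
  rewrite ler_wpM2r//; apply: le_trans (bB i).
  have [_|_|_] := sgrP (x i 0); rewrite ?scale1r ?scaleN1r ?scale0r.
  - by rewrite addr0 subrr.
  - by rewrite (le_trans (ler_norm _))// lerDl.
  - by rewrite (le_trans (ler_norm _))// lerDr.
exists B; first by rewrite sumr_ge0.
move=> x x1; rewrite ler_norml up// andbT.
have Nx : \sum_i `|(- x) i 0| = \sum_i `|x i 0|.
  by apply: eq_bigr => i _; rewrite mxE normrN.
have := up (- x); rewrite Nx => /(_ x1).
have := ch' (u + x) (u - x) (1 / 2).
have -> : (1 / 2) *: (u + x) + (1 - 1 / 2) *: (u - x) = u.
  by apply/colP => i; rewrite !mxE; field.
by move=> /(_ _ _)/wrap[| |]; lra.
Qed.

(** Phrased on row vectors, the space in which compactness and attainment of minima are invoked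
    below. *)
Lemma convex_continuous_tr {k : nat} (h : 'cV[R]_k -> R) :
  convex_function setT h -> continuous (fun x : 'rV[R]_k => h x^T).
Proof.
move=> ch u; have [B B0 HB] := convex_locally_lipschitz u^T ch.
move=> A /= /nbhs_ballP[e /= e0 eA].
pose D := (k%:R + 1) * (B + 1) : R.
have k0 : 0 <= k%:R :> R by [].
have D0 : 0 < D by rewrite mulr_gt0; lra.
(* The first bound keeps the 1-norm of the displacement below 1, the second keeps [B] times it below
   [e]. *)
pose dl := Num.min ((k%:R + 1)^-1) (e / D).
have dl0 : 0 < dl by rewrite lt_min invr_gt0 divr_gt0// ltr_wpDl.
apply/nbhs_ballP; exists dl => //= x [_ ux].
have sx : \sum_i `|(x^T - u^T) i 0| <= k%:R * dl.
  rewrite mulr_natl -[k in leRHS]card_ord -sumr_const; apply: ler_sum => i _.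
  by rewrite !mxE distrC ltW//; exact: ux.
have dl1 : dl * (k%:R + 1) <= 1.
  by rewrite -ler_pdivlMr ?ltr_wpDl// ge_min mul1r lexx.
have dle : dl * D <= e by rewrite -ler_pdivlMr// ge_min lexx orbT.
apply: eA; rewrite /ball /= distrC.
have -> : x^T = u^T + (x^T - u^T) by rewrite subrKC.
apply: le_lt_trans (HB _ _) _.
  by apply: le_lt_trans sx _; lra.
apply: lt_le_trans dle; apply: le_lt_trans (ler_wpM2l B0 sx) _.
rewrite /D; nra.
Qed.

End Convex.

(** * Minimizers of a convex function plus a quadratic *)

Section Proximal.
Context {R : realType} {k : nat}.
Implicit Types (h : 'cV[R]_k -> R) (x y v xi : 'cV[R]_k) (c : R).

Lemma convex_add_quadratic h c v : 0 <= c -> convex_function setT h ->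
  convex_function setT (fun y => h y + c / 2 * inner (y - v) (y - v)).
Proof.
move=> c0 /convex_functionP ch; apply/convex_functionP => x y t t0 t1.
have tt : 0 <= t * (1 - t) by rewrite mulr_ge0; lra.
(* Half of this quantity is exactly the convexity defect of the quadratic term. *)
have := mulr_ge0 (mulr_ge0 c0 tt) (inner_ge0 (x - y)).
have := ch x y t t0 t1.
have -> : t *: x + (1 - t) *: y - v = t *: (x - v) + (1 - t) *: (y - v).
  by apply/colP => i; rewrite !mxE; ring.
have -> : x - y = (x - v) - (y - v) by rewrite opprB addrA subrK.
move: (x - v) (y - v) => a b; rewrite !inner_linear (innerC b a); nra.
Qed.

(** A subgradient at a single point makes [phi] coercive: its sublevel set through [y0] is closed
    and bounded, hence compact, and the continuous [phi] attains its minimum there. *)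
Lemma convex_quadratic_argmin h c v xi y0 : 0 < c -> convex_function setT h ->
  subdifferential h y0 xi ->
  exists y, forall y', h y + c / 2 * inner (y - v) (y - v)
                    <= h y' + c / 2 * inner (y' - v) (y' - v).
Proof.
move=> c0 ch hxi; pose phi y := h y + c / 2 * inner (y - v) (y - v).
have cphi := convex_continuous_tr (convex_add_quadratic v (ltW c0) ch).
pose A := [set x : 'rV[R]_k | phi x^T <= phi y0].
have Ay0 : A y0^T by rewrite /A /= trmxK.
have clA : closed A.
  have -> : A = (fun x : 'rV[R]_k => phi x^T) @^-1` [set z | z <= phi y0] by [].
  by apply: preimage_closed => [x _|]; [exact: cphi|exact: closed_le].
(* On the sublevel set, [c / 2 * |y - y0|^2] is at most the inner product of
   [- (xi + c *: (y0 - v))] with [y - y0]; Cauchy-Schwarz then gives the radius [D]. *)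
pose D := 2 / c * enorm (xi + c *: (y0 - v)).
have AD y : phi y <= phi y0 -> enorm (y - y0) <= D.
  rewrite /phi /D; have := hxi y.
  have -> : y - v = (y - y0) + (y0 - v) by rewrite addrA subrK.
  move: (y - y0) (y0 - v) => a b H1 H2.
  have := inner_le_enorm (- (xi + c *: b)) a.
  have -> : enorm (- (xi + c *: b)) = enorm (xi + c *: b).
    by rewrite -scaleN1r enormZ normrN1 mul1r.
  rewrite !inner_linear (innerC b a) => H3.
  have H4 : c / 2 * (enorm a * enorm a) <= enorm (xi + c *: b) * enorm a.
    rewrite -expr2 sqr_enorm; move: H2; rewrite !inner_linear (innerC b a).
    by lra.
  have := enorm_ge0 a; rewrite le_eqVlt => /predU1P[<-|e0].
    by rewrite mulr_ge0 ?enorm_ge0// divr_ge0 ?ltW.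
  move: H4; rewrite mulrA ler_pM2r// => H4.
  rewrite -(ler_pM2l (_ : 0 < c / 2)); last lra.
  by rewrite mulrA (_ : c / 2 * (2 / c) = 1) ?mul1r//; field; rewrite gt_eqF.
have cA : compact A.
  have cK := @rV_compact R k (fun i => `[y0 i 0 - D, y0 i 0 + D]%classic)
    (fun i => @segment_compact _ _ _).
  apply: subclosed_compact clA cK _ => x /AD xD i.
  have := le_trans (coord_le_enorm (x^T - y0) i) xD.
  by rewrite !mxE ler_norml /= in_itv /=; lra.
have [|x Ax xmin] := EVT_min_rV _ cA (continuous_subspaceT cphi).
  by exists y0^T.
exists x^T => y; have [Ay|Ay] := pselect (A y^T).
  by have := xmin _ (mem_set Ay); rewrite trmxK.
move: Ax; rewrite inE /A /= => xy0; apply: le_trans xy0 _.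
by move: Ay; rewrite /A /= trmxK => /negP; rewrite -ltNge => /ltW.
Qed.

(** Replaces a limit [t -> 0] in first-order conditions: if [a < 0], then [t = - a / (b - a)] gives
    the negative value [- a^2 / (b - a)]. *)
Lemma ge0_of_affine_ge0 (a b : R) : 0 <= b ->
  (forall t : R, 0 < t -> t <= 1 -> 0 <= a + t * b) -> 0 <= a.
Proof.
move=> b0 H; rewrite leNgt; apply/negP => a0.
have ab : 0 < b - a by lra.
have := H (- a / (b - a)).
rewrite divr_gt0 ?oppr_gt0// ler_pdivrMr// => /(_ isT) H'.
have {H'}: 0 <= a + - a / (b - a) * b by apply: H'; lra.
rewrite leNgt => /negP; apply.
have -> : a + - a / (b - a) * b = - (a ^+ 2 / (b - a)).
  by field; rewrite subr_eq0 gt_eqF //; lra.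
by rewrite oppr_lt0 divr_gt0// exprn_even_gt0//= lt_eqF.
Qed.

(** Fermat's rule: compare [y] with [t *: y' + (1 - t) *: y], use convexity of [h], divide by [t]
    and let [t] tend to 0. *)
Lemma quadratic_argmin_subgradient h c v y : 0 < c -> convex_function setT h ->
  (forall y', h y + c / 2 * inner (y - v) (y - v)
           <= h y' + c / 2 * inner (y' - v) (y' - v)) ->
  subdifferential h y (c *: (v - y)).
Proof.
move=> c0 /convex_functionP ch ymin y'; rewrite -subr_ge0.
have c2 : 0 <= c / 2 by lra.
apply: (ge0_of_affine_ge0 (mulr_ge0 c2 (inner_ge0 (y' - y)))) => t t0 t1.
have := ch y' y t (ltW t0) t1; have := ymin (t *: y' + (1 - t) *: y).
have -> : t *: y' + (1 - t) *: y - v = t *: (y' - y) + (y - v).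
  by apply/colP => i; rewrite !mxE; ring.
have -> : v - y = - (y - v) by rewrite opprB.
move: (y' - y) (y - v) => a b.
rewrite !inner_linear (innerC b a) => H1 H2.
rewrite -(pmulr_rge0 _ t0); nra.
Qed.

End Proximal.

Section Prox.
Context {R : realType} {k : nat}.

(** The hypothesis makes [v - a] a subgradient of [phi] at [a], so the proximal objective at [b]
    exceeds its value at [a] by at least [|b - a|^2 / 2]. The minimizer is thus unique, and the
    choice made by [get] must be [a]. *)
Lemma prox_eq (phi : 'cV[R]_k -> \bar R) (a v : 'cV[R]_k) (r : R) :
  phi a = r%:E -> (forall b, ((r + inner (v - a) (b - a))%:E <= phi b)%E) ->
  prox phi v = a.
Proof.
move=> phia phib.
have expand (b : 'cV[R]_k) : inner (b - v) (b - v) = inner (b - a) (b - a)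
    - 2 * inner (v - a) (b - a) + inner (a - v) (a - v).
  have -> : b - v = (b - a) - (v - a) by rewrite opprB addrA subrK.
  rewrite -(opprB v a); move: (b - a) (v - a) => x y.
  rewrite !inner_linear (innerC y x); ring.
have amin b : (phi a + (2^-1 * enorm (a - v) ^+ 2)%:E <=
               phi b + (2^-1 * enorm (b - v) ^+ 2)%:E)%E.
  rewrite phia -EFinD; apply: le_trans (leeD2r _ (phib b)).
  rewrite -EFinD lee_fin !sqr_enorm (expand b).
  by have := inner_ge0 (b - a); lra.
pose A := [set u | forall u', (phi u + (2^-1 * enorm (u - v) ^+ 2)%:E <=
                               phi u' + (2^-1 * enorm (u' - v) ^+ 2)%:E)%E].
have /(_ a) := phib; have : A (prox phi v) by apply: (@getI _ A a); exact: amin.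
move: (prox phi v) => b /(_ a); have := phib b.
rewrite phia; case: (phi b) => [z| |] //; rewrite -?EFinD !lee_fin => bz za _.
move: za; rewrite !sqr_enorm (expand b) => za.
have : inner (b - a) (b - a) <= 0 by lra.
by rewrite le_eqVlt ltNge inner_ge0 orbF inner_eq0 subr_eq0 => /eqP.
Qed.

(** Divided by [tau], the proximal objective is [h] plus a quadratic; the subgradient at [y0]
    guarantees that it has a minimizer. *)
Lemma prox_subgradient (h : 'cV[R]_k -> R) (tau : R) (y0 xi v : 'cV[R]_k) :
  0 < tau -> convex_function setT h -> subdifferential h y0 xi ->
  subdifferential h (prox (fun x => (tau * h x)%:E) v)
    (tau^-1 *: (v - prox (fun x => (tau * h x)%:E) v)).
Proof.
move=> tau0 ch hxi; have tauV0 : 0 < tau^-1 by rewrite invr_gt0.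
have [y /(quadratic_argmin_subgradient tauV0 ch) hy] :=
  convex_quadratic_argmin v tauV0 ch hxi.
suff -> : prox (fun x => (tau * h x)%:E) v = y by [].
apply: prox_eq => [//|b]; rewrite lee_fin; have := ler_wpM2l (ltW tau0) (hy b).
by rewrite innerZl mulrDr mulVKf// gt_eqF.
Qed.

End Prox.

(** * Convex functions with Lipschitz gradient *)

Section Smooth.
Context {R : realType} {k : nat} (f : 'cV[R]_k -> R).
Hypothesis f_diff : forall x, differentiable f x.

Lemma derive_gradient x v : 'D_v f x = inner (gradient f x) v.
Proof.
rewrite deriveE// innerE.
have {1}-> : v = \sum_i v i 0 *: delta_mx i 0.
  by rewrite {1}[v]matrix_sum_delta; apply: eq_bigr => i _; rewrite big_ord1.
rewrite linear_sum; apply: eq_bigr => i _.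
by rewrite linearZ mxE deriveE// mulrC.
Qed.

Lemma is_derive_line x v (t : R) :
  is_derive t 1 (fun t => f (x + t *: v)) (inner (gradient f (x + t *: v)) v).
Proof.
have E : (fun h : R => h^-1 *: (((fun t => f (x + t *: v)) \o shift t) (h *: 1)
      - f (x + t *: v))) =
    (fun h => h^-1 *: ((f \o shift (x + t *: v)) (h *: v) - f (x + t *: v))).
  apply/funext => h /=; congr (_ *: (f _ - _)).
  by rewrite scalerDl addrCA; congr (_ + _); rewrite /GRing.scale /= mulr1.
split; first by rewrite /derivable E; exact: diff_derivable.
by rewrite /derive E -derive_gradient.
Qed.

Variable L : R.
Hypothesis f_smooth : forall x y,
  enorm (gradient f x - gradient f y) <= L * enorm (x - y).

Lemma smooth_quadratic_bound x v :
  `|f (x + v) - f x - inner (gradient f x) v| <= L / 2 * inner v v.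
Proof.
(* The mean value theorem on [psi] stands in for integrating the gradient. The subtracted multiple
   of [t ^+ 2] keeps the constant [L / 2]; [s = 1] yields the upper bound and [s = -1] the lower
   one. *)
have H (s : R) : exists2 c, 0 <= c <= 1 & f (x + v) - f x - inner (gradient f x) v
   - s * (L / 2) * inner v v =
   inner (gradient f (x + c *: v) - gradient f x) v - s * L * c * inner v v.
  pose psi t := f (x + t *: v) - t * inner (gradient f x) v
     - t ^+ 2 * (s * (L / 2) * inner v v).
  pose dpsi t := inner (gradient f (x + t *: v)) v - inner (gradient f x) v
     - (2 * t) * (s * (L / 2) * inner v v).
  have D (t : R) : is_derive t 1 psi (dpsi t).
    have Dl := is_derive_line x v t.
    have -> : psi = (fun t => f (x + t *: v)) -
      ((inner (gradient f x) v) \*: id) -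
      ((s * (L / 2) * inner v v) \*: (id ^+ 2)).
      by apply/funext => z; rewrite /psi !fctE /= /GRing.scale /=; ring.
    by apply: is_derive_eq; rewrite /dpsi /GRing.scale /=; ring.
  have [|c c01] := MVT (@ltr01 R) (fun t _ => D t).
    apply: derivable_within_continuous => t _. by case: (D t).
  rewrite /psi /dpsi !subr0 mulr1 expr1n expr0n /= !mul0r !scale0r addr0 scale1r.
  rewrite !mul1r !subr0 => E; exists c.
    by move: c01; rewrite in_itv /= => /andP[/ltW-> /ltW->].
  by rewrite innerDl innerNl; lra.
have Lc c : 0 <= c <= 1 ->
    `|inner (gradient f (x + c *: v) - gradient f x) v| <= L * c * inner v v.
  move=> /andP[c0 c1].
  have B : enorm (gradient f (x + c *: v) - gradient f x) * enorm v
      <= L * c * inner v v.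
    rewrite -sqr_enorm expr2 mulrA ler_wpM2r ?enorm_ge0//.
    apply: le_trans (f_smooth _ _) _.
    by rewrite addrAC subrr add0r enormZ ger0_norm// mulrA.
  rewrite ler_norml (le_trans (inner_le_enorm _ _) B) andbT lerNl -innerNl.
  apply: le_trans (inner_le_enorm _ _) _.
  by rewrite -scaleN1r enormZ normrN1 mul1r.
rewrite ler_norml.
have [c /Lc] := H 1; have [c' /Lc] := H (-1); rewrite !ler_norml.
by move=> /andP[? ?] ? /andP[? ?] ?; lra.
Qed.

(** By the quadratic bound at small [t], [gradient f x - xi] has nonnegative inner product with
    every vector, its own opposite included. *)
Lemma smooth_subgradient_unique x xi :
  0 <= L -> subdifferential f x xi -> xi = gradient f x.
Proof.
move=> L0 fxi.
have H v : 0 <= inner (gradient f x - xi) v.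
  apply: (@ge0_of_affine_ge0 _ _ (L / 2 * inner v v)) => [|t t0 t1].
    by rewrite mulr_ge0 ?inner_ge0//; lra.
  have := fxi (x + t *: v); have := smooth_quadratic_bound x (t *: v).
  rewrite (addrC x) addrK !innerDl !innerNl !innerZr !innerZl ler_norml.
  by move=> /andP[_ H1] H2; rewrite -(pmulr_rge0 _ t0); nra.
apply/esym/eqP; rewrite -subr_eq0 -inner_eq0 eq_le inner_ge0 andbT.
by rewrite -oppr_ge0 -innerNr.
Qed.

Hypothesis f_convex : convex_function setT f.

Lemma convex_gradient_subdifferential x :
  0 <= L -> subdifferential f x (gradient f x).
Proof.
move=> L0 y; rewrite -subr_ge0; set v := y - x.
apply: (@ge0_of_affine_ge0 _ _ (L / 2 * inner v v)) => [|t t0 t1].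
  by rewrite mulr_ge0 ?inner_ge0//; lra.
have := smooth_quadratic_bound x (t *: v).
have /convex_functionP/(_ y x t (ltW t0) t1) := f_convex.
have -> : t *: y + (1 - t) *: x = x + t *: v.
  by apply/colP => i; rewrite !mxE; ring.
rewrite !innerZr !innerZl ler_norml => H1 /andP[H2 H3].
by rewrite -(pmulr_rge0 _ t0); nra.
Qed.

(* The gradient step from [y] for [f - <gradient f x, .>], which is minimal at
   [x], decreases that function enough. *)
Lemma convex_smooth_lower_bound x y : 0 < L ->
  f x + inner (gradient f x) (y - x) + (2 * L)^-1 *
    inner (gradient f y - gradient f x) (gradient f y - gradient f x) <= f y.
Proof.
move=> L0; set g := gradient f y - gradient f x.
have := smooth_quadratic_bound y (- L^-1 *: g).
have := convex_gradient_subdifferential x (ltW L0) (y + (- L^-1 *: g)).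
have -> : y + - L^-1 *: g - x = (y - x) + - L^-1 *: g by rewrite addrAC.
rewrite ler_norml => H1 /andP[_ H2].
have E : (2 * L)^-1 * inner g g = L^-1 * (inner (gradient f y) g -
    inner (gradient f x) g) - L / 2 * (- L^-1 * (- L^-1 * inner g g)).
  by rewrite -innerNl -innerDl -/g; field; lra.
by move: H1 H2; rewrite E innerDr !innerZr !innerZl; lra.
Qed.

(* Baillon-Haddad *)
Lemma gradient_cocoercive x y : 0 < L ->
  inner (gradient f x - gradient f y) (gradient f x - gradient f y)
    <= L * inner (gradient f x - gradient f y) (x - y).
Proof.
move=> L0; have H := convex_smooth_lower_bound.
(* In the sum of the two lower bounds the function values cancel. *)
have := lerD (H x y L0) (H y x L0).
have -> : gradient f y - gradient f x = - (gradient f x - gradient f y).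
  by rewrite opprB.
have -> : y - x = - (x - y) by rewrite opprB.
set g := gradient f x - gradient f y; set v := x - y.
have -> : inner g v = inner (gradient f x) v - inner (gradient f y) v.
  by rewrite innerDl innerNl.
rewrite !innerNl !innerNr opprK invfM => H1.
have : L^-1 * inner g g <= inner (gradient f x) v - inner (gradient f y) v.
  by lra.
by rewrite ler_pdivrMl.
Qed.

End Smooth.

(** * Conjugates and contraction by proximal updates *)

Section Conjugate.
Context {R : realType} {k : nat}.

Lemma fenchel_young (f : 'cV[R]_k -> R) a u :
  ((inner a u - f u)%:E <= conjugate f a)%E.
Proof. by apply: ereal_sup_ubound; exists u. Qed.

(** Equality in Fenchel-Young: the subgradient inequality says that [u = y] attains the supremum. *)
Lemma conjugate_subgradient (f : 'cV[R]_k -> R) y a :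
  subdifferential f y a -> conjugate f a = (inner a y - f y)%:E.
Proof.
move=> fa; apply/eqP; rewrite eq_le fenchel_young andbT.
apply: ub_ereal_sup => _ [u _ <-]; rewrite lee_fin.
by have := fa u; rewrite innerDr innerNr; lra.
Qed.

(** Optimality of the proximal step gives a subgradient at [w']. Adding strong convexity there and
    at [wstar] yields strong monotonicity of the subdifferential, which is then scaled by [tau]. *)
Lemma strong_prox_contraction (h : 'cV[R]_k -> R) (lambda tau : R)
    (w w' wstar v vstar : 'cV[R]_k) :
  0 < tau -> convex_function setT h ->
  (forall x y xi, subdifferential h x xi ->
     h x + inner xi (y - x) + lambda / 2 * enorm (y - x) ^+ 2 <= h y) ->
  subdifferential h wstar vstar ->
  w' = prox (fun x => (tau * h x)%:E) (w + tau *: v) ->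
  (1 + tau * lambda) * inner (w' - wstar) (w' - wstar)
    <= inner (w' - wstar) (w - wstar + tau *: (v - vstar)).
Proof.
move=> tau0 ch sh hstar w'E.
have := prox_subgradient (w + tau *: v) tau0 ch hstar.
rewrite -w'E => /(sh _ wstar _).
have := sh _ w' _ hstar; rewrite !sqr_enorm.
set e := w' - wstar; have -> : wstar - w' = - e by rewrite opprB.
have -> : w + tau *: v - w' =
    - e + (w - wstar + tau *: (v - vstar)) + tau *: vstar.
  by apply/colP => i; rewrite !mxE; ring.
move: (w - wstar + _) => b; clearbody e; rewrite !inner_linear => H1 H2.
rewrite (innerC e b).
have : 0 <= tau^-1 * (- inner e e + inner b e - tau * lambda * inner e e).
  have -> : tau^-1 * (- inner e e + inner b e - tau * lambda * inner e e) =
    tau^-1 * (- inner e e + inner b e) - lambda * inner e e.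
    by field; rewrite gt_eqF.
  have : tau^-1 * (tau * inner vstar e) = inner vstar e.
    by rewrite mulKf// gt_eqF.
  by lra.
by rewrite pmulr_rge0 ?invr_gt0//; lra.
Qed.

Section Smooth.
Variables (f : 'cV[R]_k -> R) (gamma : R).
Hypotheses (gamma_gt0 : 0 < gamma) (f_convex : convex_function setT f)
  (f_diff : forall x, differentiable f x)
  (f_smooth : forall x y,
     enorm (gradient f x - gradient f y) <= gamma^-1 * enorm (x - y)).

Let L_gt0 : 0 < gamma^-1.
Proof. by rewrite invr_gt0. Qed.

(* Moreau decomposition. *)
Lemma prox_conjugate (sigma : R) (v : 'cV[R]_k) : 0 < sigma ->
  exists2 y, v = gradient f y + sigma *: y &
    prox (fun a => (sigma%:E * conjugate f a)%E) v = gradient f y.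
Proof.
move=> s0; have gradP := convex_gradient_subdifferential f_diff f_smooth f_convex.
(* [y] is the proximal point of [f / sigma] at [v / sigma]; its optimality condition is the required
   decomposition of [v]. *)
have [y /(quadratic_argmin_subgradient s0 f_convex) fy] :=
  convex_quadratic_argmin (sigma^-1 *: v) s0 f_convex (gradP 0 (ltW L_gt0)).
have gy := smooth_subgradient_unique f_diff f_smooth (ltW L_gt0) fy.
exists y; first by rewrite -gy scalerBr scalerA divff ?gt_eqF// scale1r subrK.
have vy : v - gradient f y = sigma *: y.
  by rewrite -gy scalerBr scalerA divff ?gt_eqF// scale1r opprB addrCA subrr addr0.
have cy := conjugate_subgradient (gradP y (ltW L_gt0)).
apply: (prox_eq (r := sigma * (inner (gradient f y) y - f y))).
  by rewrite cy -EFinM.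
move=> b; rewrite vy; apply: le_trans (lee_wpmul2l _ (fenchel_young f b y)).
  rewrite -EFinM lee_fin innerZl -mulrDr innerDr innerNr.
  by rewrite (innerC y) (innerC y); apply: ler_wpM2l; lra.
by rewrite lee_fin ltW.
Qed.

(** Moreau's decomposition writes [a'] as [gradient f y], and cocoercivity between [y] and [ustar]
    plays the part of strong monotonicity of the subdifferential of the conjugate. *)
Lemma conjugate_prox_contraction (sigma : R) (a a' astar u ustar : 'cV[R]_k) :
  0 < sigma -> astar = gradient f ustar ->
  a' = prox (fun x => (sigma%:E * conjugate f x)%E) (a + sigma *: u) ->
  (1 + sigma * gamma) * inner (a' - astar) (a' - astar)
    <= inner (a' - astar) (a - astar + sigma *: (u - ustar)).
Proof.
move=> s0 astarE ->.
have [y vE ->] := prox_conjugate (a + sigma *: u) s0.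
have := gradient_cocoercive f_diff f_smooth f_convex y ustar L_gt0.
rewrite -astarE; move: (gradient f y) vE => {}a' vE.
rewrite ler_pdivlMl// => H.
have -> : a - astar + sigma *: (u - ustar) =
    (a' - astar) + sigma *: (y - ustar).
  have -> : a = a' + sigma *: y - sigma *: u by rewrite -vE addrK.
  by apply/colP => i; rewrite !mxE; ring.
by rewrite [leRHS]innerDr innerZr mulrDl mul1r lerD2l -mulrA ler_wpM2l// ltW.
Qed.

End Smooth.
End Conjugate.

(** * Blocks and the saddle point *)

Lemma submxcolZ (R : realType) (n : nat) (d : 'I_n -> nat) (c : R)
    (w : 'cV[R]_(\sum_k d k)) k : submxcol (c *: w) k = c *: submxcol w k.
Proof. by apply/colP => i; rewrite !mxE. Qed.

Section Blocks.
Context {R : realType}.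

Lemma inner_submxcol {n : nat} {d : 'I_n -> nat} (x y : 'cV[R]_(\sum_k d k)) :
  inner x y = \sum_k inner (submxcol x k) (submxcol y k).
Proof.
rewrite /inner -{1}(submxcolK x) -{1}(submxcolK y) tr_mxcol mul_mxrow_mxcol.
by rewrite summxE.
Qed.

Lemma submxcol_mulmx {m n : nat} {N : 'I_m -> nat} {d : 'I_n -> nat}
    (X : 'M[R]_(\sum_i N i, \sum_k d k)) (w : 'cV[R]_(\sum_k d k)) i :
  submxcol (X *m w) i = \sum_k submxblock X i k *m submxcol w k.
Proof.
rewrite -submxcol_mul -[submxcol X i]submxrowK -{1}(submxcolK w).
by rewrite mul_mxrow_mxcol; apply: eq_bigr => k _; rewrite -submxblockEv.
Qed.

Lemma submxcol_trmx_mulmx {m n : nat} {N : 'I_m -> nat} {d : 'I_n -> nat}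
    (X : 'M[R]_(\sum_i N i, \sum_k d k)) (a : 'cV[R]_(\sum_i N i)) k :
  submxcol (X^T *m a) k = \sum_i (submxblock X i k)^T *m submxcol a i.
Proof.
rewrite submxcol_mulmx; apply: eq_bigr => i _; congr (_ *m _).
by apply/matrixP => r s; rewrite !mxE.
Qed.

Definition update_block {n : nat} {d : 'I_n -> nat} (w : 'cV[R]_(\sum_k d k))
    k (x : 'cV[R]_(d k)) : 'cV[R]_(\sum_k d k) :=
  \mxcol_i eqtype.dfwith (submxcol w) x i.

Lemma update_block_in {n : nat} {d : 'I_n -> nat} w k (x : 'cV[R]_(d k)) :
  submxcol (update_block w x) k = x.
Proof. by rewrite mxcolK dfwith_in. Qed.

Lemma update_block_out {n : nat} {d : 'I_n -> nat} w k (x : 'cV[R]_(d k)) j :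
  k != j -> submxcol (update_block w x) j = submxcol w j.
Proof. by move=> kj; rewrite mxcolK dfwith_out. Qed.

Section Separable.
Context {n : nat} {d : 'I_n -> nat} (g : forall k, 'cV[R]_(d k) -> R).
Implicit Types (k : 'I_n) (w xi : 'cV[R]_(\sum_k d k)).

Lemma big_update_block (G : forall k, 'cV[R]_(d k) -> R) w k (x : 'cV[R]_(d k)) :
  \sum_j G j (submxcol (update_block w x) j) =
  G k x + \sum_(j | j != k) G j (submxcol w j).
Proof.
rewrite (bigD1 k)//= update_block_in; congr (_ + _).
by apply: eq_bigr => j jk; rewrite update_block_out 1?eq_sym.
Qed.

Lemma subdifferential_block w xi k :
  subdifferential (separable_sum (@g)) w xi ->
  subdifferential (@g k) (submxcol w k) (submxcol xi k).
Proof.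
move=> gxi x; have := gxi (update_block w x).
rewrite /separable_sum big_update_block inner_submxcol.
under [X in _ + X <= _]eq_bigr do rewrite submxcolB.
rewrite (big_update_block (fun j y => inner (submxcol xi j) (y - submxcol w j))).
rewrite [X in _ + (_ + X)]big1 ?addr0; last first.
  by move=> j _; rewrite subrr innerC inner0l.
by rewrite (bigD1 k)//=; lra.
Qed.

Lemma subdifferential_separable w xi :
  (forall k, subdifferential (@g k) (submxcol w k) (submxcol xi k)) ->
  subdifferential (separable_sum (@g)) w xi.
Proof.
move=> gxi w'; rewrite /separable_sum inner_submxcol -big_split /=.
by apply: ler_sum => k _; rewrite submxcolB; exact: gxi.
Qed.

Lemma convex_block k :
  convex_function setT (separable_sum (@g)) -> convex_function setT (@g k).
Proof.
move=> /convex_functionP cg; apply/convex_functionP => x y t t0 t1.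
pose W (z : 'cV[R]_(d k)) := update_block (0 : 'cV[R]_(\sum_k d k)) z.
have := cg (W x) (W y) t t0 t1.
have -> : t *: W x + (1 - t) *: W y = W (t *: x + (1 - t) *: y).
  apply/mxcolP => i; rewrite submxcolD.
  rewrite !submxcolZ; have [<-|ki] := eqVneq k i; first by rewrite !update_block_in.
  by rewrite !update_block_out// submxcol0 !scaler0 addr0.
by rewrite /separable_sum !big_update_block; lra.
Qed.

(** Strong convexity speaks of subgradients of the whole sum. The subgradient [xi] at [w] fills in
    the blocks other than [k], which completes [zeta] to such a subgradient. *)
Lemma strongly_convex_block lambda w xi k (x y zeta : 'cV[R]_(d k)) :
  strongly_convex lambda (separable_sum (@g)) ->
  subdifferential (separable_sum (@g)) w xi ->
  subdifferential (@g k) x zeta ->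
  @g k x + inner zeta (y - x) + lambda / 2 * enorm (y - x) ^+ 2 <= @g k y.
Proof.
move=> [_ sg] gxi gx.
have gZ : subdifferential (separable_sum (@g)) (update_block w x)
    (update_block xi zeta).
  apply: subdifferential_separable => j.
  have [<-|kj] := eqVneq k j; first by rewrite !update_block_in.
  by rewrite !update_block_out//; exact: subdifferential_block.
have := sg _ (update_block w y) _ gZ.
have -> : update_block w y - update_block w x = update_block 0 (y - x).
  apply/mxcolP => i; rewrite submxcolB.
  have [<-|ki] := eqVneq k i; first by rewrite !update_block_in.
  by rewrite !update_block_out// subrr submxcol0.
rewrite !sqr_enorm !inner_submxcol.
rewrite [X in _ + X + _ <= _](bigD1 k)//= [X in _ + _ * X <= _](bigD1 k)//=.
rewrite !update_block_in big1 ?[X in _ + _ * (_ + X) <= _]big1; last 2 first.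
- by move=> j jk; rewrite !update_block_out 1?eq_sym// submxcol0 inner0l.
- by move=> j jk; rewrite !update_block_out 1?eq_sym// submxcol0 innerC inner0l.
by rewrite /separable_sum !big_update_block; lra.
Qed.

End Separable.
End Blocks.

(** * Optimality conditions at the saddle point *)

Section Saddle.
Context {R : realType} {m n : nat} {N : 'I_m -> nat} {d : 'I_n -> nat}.
Variables (X : 'M[R]_(\sum_i N i, \sum_k d k))
  (f : forall i, 'cV[R]_(N i) -> R) (g : forall k, 'cV[R]_(d k) -> R)
  (gamma : 'I_m -> R).
Hypotheses (m_gt0 : (0 < m)%N) (gamma_gt0 : forall i, 0 < gamma i)
  (f_convex : forall i, convex_function setT (@f i))
  (f_diff : forall i x, differentiable (@f i) x)
  (f_smooth : forall i x y,
     enorm (gradient (@f i) x - gradient (@f i) y)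
       <= (gamma i)^-1 * enorm (x - y)).
Variables (wstar : 'cV[R]_(\sum_k d k)) (astar : 'cV[R]_(\sum_i N i)).
Hypothesis saddle : saddle_point (lagrangian X f g) wstar astar.

Lemma lagrangianE (c : 'I_m -> R) w a :
  (forall i, conjugate (@f i) (submxcol a i) = (c i)%:E) ->
  lagrangian X f g w a =
  (m%:R^-1 * \sum_i (inner (submxcol a i) (submxcol X i *m w) - c i)
     + separable_sum g w)%:E.
Proof.
move=> ca; rewrite /lagrangian (eq_bigr (fun i => (c i)%:E)); last by move=> i _.
rewrite sumEFin -EFinM -EFinB -EFinD; congr _%:E.
by rewrite sumrB; ring.
Qed.

(** An infinite conjugate would make the Lagrangian [-oo] at the saddle point, below its finite
    value at the dual point formed by the gradients at 0. *)
Lemma saddle_conjugate_fin :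
  exists c : 'I_m -> R, forall i, conjugate (@f i) (submxcol astar i) = (c i)%:E.
Proof.
pose a := \mxcol_i gradient (@f i) 0.
have [H _] := saddle wstar a.
suff fin i : conjugate (@f i) (submxcol astar i) \is a fin_num.
  exists (fun i => fine (conjugate (@f i) (submxcol astar i))) => i.
  by rewrite fineK.
have NyP j : conjugate (@f j) (submxcol astar j) != -oo%E.
  by rewrite -ltNye (lt_le_trans _ (fenchel_young _ _ 0)) ?ltNyr.
rewrite fin_numE NyP /=; apply/eqP => fy.
have L0 j : 0 <= (gamma j)^-1 by rewrite invr_ge0 ltW.
have aE j : conjugate (@f j) (submxcol a j) =
    (inner (gradient (@f j) 0) 0 - @f j 0)%:E.
  rewrite mxcolK; apply: conjugate_subgradient.
  exact: (convex_gradient_subdifferential (@f_diff j) (@f_smooth j)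
    (@f_convex j) _ (L0 j)).
move: H; rewrite (lagrangianE _ aE) /lagrangian.
have -> : (\sum_i conjugate (@f i) (submxcol astar i) = +oo)%E.
  by apply/esum_eqyP => [j _|]; [exact: NyP | exists i].
rewrite gt0_muley; last by rewrite lte_fin invr_gt0 ltr0n.
by case.
Qed.

(** Comparison with the dual point [a], where Fenchel-Young is an equality, shows that the
    Fenchel-Young gaps of [astar] have sum at most 0. Being nonnegative they all vanish, so each
    block of [astar] is a subgradient, hence the gradient. *)
Lemma saddle_dual i :
  submxcol astar i = gradient (@f i) (submxcol X i *m wstar).
Proof.
have [c cE] := saddle_conjugate_fin.
pose u j := submxcol X j *m wstar.
pose a := \mxcol_j gradient (@f j) (u j).
have L0 j : 0 <= (gamma j)^-1 by rewrite invr_ge0 ltW.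
have gradP j y := convex_gradient_subdifferential (@f_diff j) (@f_smooth j)
  (@f_convex j) y (L0 j).
have aE j : conjugate (@f j) (submxcol a j) =
    (inner (gradient (@f j) (u j)) (u j) - @f j (u j))%:E.
  by rewrite mxcolK; apply: conjugate_subgradient; exact: gradP.
have [H _] := saddle wstar a; move: H.
rewrite (lagrangianE _ aE) (lagrangianE _ cE) lee_fin lerD2r.
rewrite ler_pM2l ?invr_gt0 ?ltr0n// => H.
have gap j : 0 <= f (u j) - (inner (submxcol astar j) (u j) - c j).
  by have := fenchel_young (@f j) (submxcol astar j) (u j); rewrite cE lee_fin; lra.
have : \sum_j (@f j (u j) - (inner (submxcol astar j) (u j) - c j)) <= 0.
  rewrite sumrB subr_le0; apply: le_trans H.
  by apply: ler_sum => j _; rewrite mxcolK -/(u j); lra.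
rewrite le_eqVlt ltNge sumr_ge0 ?orbF; last by move=> j _; exact: gap.
rewrite psumr_eq0; last by move=> j _; exact: gap.
move=> /allP/(_ i); rewrite mem_index_enum => /(_ isT) /= /eqP ci.
apply: (smooth_subgradient_unique (@f_diff i) (@f_smooth i) (L0 i)) => y.
have := fenchel_young (@f i) (submxcol astar i) y.
by rewrite cE lee_fin innerDr innerNr -/(u i); lra.
Qed.

(** At [astar] the Lagrangian is, up to a constant, a linear function of [w] plus the separable sum,
    so minimality in [w] is the subgradient inequality. *)
Lemma saddle_primal :
  subdifferential (separable_sum g) wstar (- (m%:R^-1 *: (X^T *m astar))).
Proof.
have [c cE] := saddle_conjugate_fin => w.
have [_] := saddle w astar; rewrite !(lagrangianE _ cE) lee_fin.
have E v : \sum_i (inner (submxcol astar i) (submxcol X i *m v) - c i) =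
    inner astar (X *m v) - \sum_i c i.
  rewrite sumrB inner_submxcol; congr (_ - _).
  by apply: eq_bigr => i _; rewrite submxcol_mul.
rewrite !E innerNl innerZl inner_mulmx trmxK mulmxBr innerDr innerNr; lra.
Qed.

End Saddle.

(** * One step *)

Section HalfStep.
Context {R : realType}.

(** With [c = kappa * (theta - 1)] and [sigma = 1 / (2 * c)], multiply the contraction by [2 * c]
    and polarize the product of [e] and [e']. The resulting [- c * |e' - e|^2] absorbs the product
    of [e' - e] and [dlt] at the cost of [|dlt|^2 / (4 * c)]. *)
Lemma block_progress {k : nat} (kappa theta sigma : R) (e e' dlt : 'cV[R]_k) :
  0 < kappa -> 1 < theta -> sigma = 1 / (2 * kappa * (theta - 1)) ->
  (1 + sigma * kappa) * inner e' e' <= inner e' (e + sigma *: dlt) ->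
  kappa * theta * (inner e' e' - inner e e) <=
  - kappa * inner e e + inner dlt e
    + (4 * kappa * (theta - 1))^-1 * inner dlt dlt.
Proof.
move=> k0 t1 sE; pose c := kappa * (theta - 1).
have c0 : 0 < c by rewrite mulr_gt0 ?subr_gt0.
have -> : kappa * theta = c + kappa by rewrite /c; ring.
have -> : 4 * kappa * (theta - 1) = 4 * c by rewrite /c; ring.
have {}sE : sigma = (2 * c)^-1 by rewrite sE /c mul1r mulrA.
(* Young's inequality for the product of [e' - e] and [dlt] *)
have := inner_ge0 ((2 * c) *: (e' - e) - dlt).
rewrite !inner_linear (innerC e' e) (innerC dlt e) (innerC dlt e') => H1 H2.
have H3 : 0 <= (2 * c) * (inner e e' + sigma * inner e' dlt) -
    2 * c * ((1 + sigma * kappa) * inner e' e').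
  by rewrite subr_ge0 ler_wpM2l//; lra.
have E3 : (2 * c) * (inner e e' + sigma * inner e' dlt) -
    2 * c * ((1 + sigma * kappa) * inner e' e') =
    2 * c * inner e e' + inner e' dlt - (2 * c + kappa) * inner e' e'.
  by rewrite sE; field; lra.
have H4 : 0 <= c * inner e' e' - 2 * c * inner e e' + c * inner e e
    - inner e' dlt + inner e dlt + (4 * c)^-1 * inner dlt dlt.
  apply: le_trans (mulr_ge0 (_ : 0 <= (4 * c)^-1) H1) _.
    by rewrite invr_ge0; lra.
  by rewrite le_eqVlt; apply/orP; left; apply/eqP; field; lra.
move: H3 H4; rewrite E3; lra.
Qed.

Lemma inner_sqrD_le {k : nat} (a b : 'cV[R]_k) :
  inner (a + b) (a + b) <= 2 * inner a a + 2 * inner b b.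
Proof.
by have := inner_ge0 (a - b); rewrite !inner_linear (innerC b a); lra.
Qed.

(** The variance is the second moment minus [|mu|^2]. *)
Lemma variance_le {k n : nat} (q : 'I_n -> R) (b : 'I_n -> 'cV[R]_k) :
  \sum_l q l = 1 ->
  \sum_l q l * inner (b l - \sum_i q i *: b i) (b l - \sum_i q i *: b i)
    <= \sum_l q l * inner (b l) (b l).
Proof.
move=> q1; set mu := \sum_i q i *: b i.
have E : \sum_l q l * inner (b l) mu = inner mu mu.
  by rewrite {2}/mu inner_suml; apply: eq_bigr => l _; rewrite innerZl.
rewrite (eq_bigr (fun l => q l * inner (b l) (b l) -
  (2 * (q l * inner (b l) mu) - q l * inner mu mu))); last first.
  by move=> l _; clearbody mu; rewrite !inner_linear (innerC mu (b l)); ring.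
rewrite sumrB lerBlDr lerDl sumrB -mulr_sumr E -mulr_suml q1.
by have := inner_ge0 mu; lra.
Qed.

Section Average.
Context {k n : nat} {d : 'I_n -> nat}.
Variables (q : 'I_n -> R) (Y : forall l, 'M[R]_(k, d l))
  (x xbar : forall l, 'cV[R]_(d l)).
Hypotheses (q_gt0 : forall l, 0 < q l) (q_sum : \sum_l q l = 1).

(** The stochastic direction minus its value at the saddle point, with [x] and [xbar] as deviations
    from that point. One formula serves both halves: [Y] is a block row of [X] for the dual, a
    scaled, negated and transposed block column for the primal. *)
Definition svrg_direction l : 'cV[R]_k :=
  \sum_i Y i *m xbar i + (q l)^-1 *: (Y l *m (x l - xbar l)).

(** Unbiasedness: the weight [q l] cancels its inverse, and the reference terms in [xbar] cancel
    each other. *)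
Lemma svrg_direction_mean (y : 'cV[R]_k) :
  \sum_l q l * inner (svrg_direction l) y = inner (\sum_l Y l *m x l) y.
Proof.
have E l : q l * inner (svrg_direction l) y =
    q l * inner (\sum_i Y i *m xbar i) y +
    (inner (Y l *m x l) y - inner (Y l *m xbar l) y).
  rewrite innerDl innerZl mulrDr mulVKf ?gt_eqF// mulmxBr.
  by rewrite [inner (_ - _) _]innerDl innerNl.
rewrite (eq_bigr _ (fun l _ => E l)) big_split -mulr_suml q_sum mul1r /=.
by rewrite sumrB -!inner_suml subrKC.
Qed.

Variable s : 'I_n -> R.
Hypothesis Y_bound : forall l z, enorm (Y l *m z) <= s l * enorm z.

(** The direction is [a l] minus the centred [b l], both importance-weighted. Splitting the square
    costs a factor 2, and the variance of [b] is at most its second moment. *)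
Lemma svrg_direction_sqr_le :
  \sum_l q l * inner (svrg_direction l) (svrg_direction l) <=
  \sum_l 2 * (s l ^+ 2 / q l) * (inner (x l) (x l) + inner (xbar l) (xbar l)).
Proof.
pose a l := (q l)^-1 *: (Y l *m x l); pose b l := (q l)^-1 *: (Y l *m xbar l).
have muE : \sum_i q i *: b i = \sum_i Y i *m xbar i.
  by apply: eq_bigr => i _; rewrite scalerA divff ?scale1r// gt_eqF.
have dE l : svrg_direction l = a l + - (b l - \sum_i q i *: b i).
  by rewrite muE /svrg_direction mulmxBr scalerBr opprB addrCA.
have sq l (z : 'cV[R]_(d l)) :
    q l * inner ((q l)^-1 *: (Y l *m z)) ((q l)^-1 *: (Y l *m z))
    <= s l ^+ 2 / q l * inner z z.
  rewrite innerZl innerZr mulVKf ?gt_eqF// mulrC mulrAC ler_wpM2r//.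
    by rewrite invr_ge0 ltW.
  rewrite -!sqr_enorm -exprMn ler_sqr ?nnegrE ?enorm_ge0//.
  exact: le_trans (enorm_ge0 _) (Y_bound z).
apply: (@le_trans _ _ (\sum_l q l * (2 * inner (a l) (a l) +
   2 * inner (b l - \sum_i q i *: b i) (b l - \sum_i q i *: b i)))).
  apply: ler_sum => l _; rewrite ler_wpM2l ?(ltW (q_gt0 l))// dE.
  by apply: le_trans (inner_sqrD_le _ _) _; rewrite innerNl innerNr opprK.
under eq_bigr => l _ do rewrite mulrDr !(mulrCA (q l)).
under [leRHS]eq_bigr => l _ do rewrite -mulrA mulrDr.
rewrite -mulr_sumr !big_split /= -!mulr_sumr.
have A : \sum_l q l * inner (a l) (a l) <=
    \sum_l s l ^+ 2 / q l * inner (x l) (x l) by apply: ler_sum => l _; exact: sq.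
have B : \sum_l q l * inner (b l) (b l) <=
    \sum_l s l ^+ 2 / q l * inner (xbar l) (xbar l).
  by apply: ler_sum => l _; exact: sq.
have V := variance_le b q_sum.
lra.
Qed.

(** Averages the one-block progress over the other pick. The condition on [B] is what turns the
    second moment, divided by [4 * kappa * (theta - 1)], into the budget [B l] per block. *)
Lemma half_step_decrease (kappa theta sigma : R) (B : 'I_n -> R)
    (e : 'cV[R]_k) (e' : 'I_n -> 'cV[R]_k) :
  0 < kappa -> 1 < theta -> sigma = 1 / (2 * kappa * (theta - 1)) ->
  (forall l, s l ^+ 2 / q l <= 2 * kappa * (theta - 1) * B l) ->
  (forall l, (1 + sigma * kappa) * inner (e' l) (e' l)
               <= inner (e' l) (e + sigma *: svrg_direction l)) ->
  kappa * theta * (\sum_l q l * inner (e' l) (e' l) - inner e e) <=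
  - kappa * inner e e + inner (\sum_l Y l *m x l) e
    + \sum_l B l * (inner (x l) (x l) + inner (xbar l) (xbar l)).
Proof.
move=> k0 t1 sE sB H.
have c0 : 0 < kappa * (theta - 1) by rewrite mulr_gt0 ?subr_gt0.
have qs (c : R) : \sum_l q l * c = c by rewrite -mulr_suml q_sum mul1r.
apply: (@le_trans _ _ (\sum_l q l * (- kappa * inner e e +
  inner (svrg_direction l) e + (4 * kappa * (theta - 1))^-1 *
    inner (svrg_direction l) (svrg_direction l)))).
  rewrite -{1}(qs (inner e e)) -sumrB mulr_sumr; apply: ler_sum => l _.
  rewrite -mulrBr mulrCA ler_wpM2l ?(ltW (q_gt0 l))//.
  exact: block_progress (H l).
under eq_bigr => l _ do rewrite !mulrDr [q l * (_^-1 * _)]mulrCA.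
rewrite !big_split /= qs svrg_direction_mean lerD2l -mulr_sumr.
rewrite ler_pdivrMl; last by lra.
apply: le_trans svrg_direction_sqr_le _; rewrite mulr_sumr; apply: ler_sum => l _.
rewrite [leRHS]mulrA ler_wpM2r ?addr_ge0 ?inner_ge0//.
by have := sB l; lra.
Qed.

End Average.
End HalfStep.

Lemma big_change_one {V : zmodType} {I : finType} (F G : I -> V) (i : I) :
  (forall k, k != i -> F k = G k) ->
  \sum_k F k = \sum_k G k + (F i - G i).
Proof.
move=> FG; rewrite (bigD1 i)//= [X in _ = X + _](bigD1 i)//= (eq_bigr _ FG).
by rewrite addrAC subrKC.
Qed.

Lemma OmegaE (R : realType) (m n : nat) (N : 'I_m -> nat) (d : 'I_n -> nat)
    (lambda : R) (gamma : 'I_m -> R) (w : 'cV[R]_(\sum_k d k))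
    (a : 'cV[R]_(\sum_i N i)) :
  Omega lambda gamma w a =
  lambda * (\sum_k inner (submxcol w k) (submxcol w k)) +
  m%:R^-1 * \sum_i gamma i * inner (submxcol a i) (submxcol a i).
Proof.
rewrite /Omega sqr_enorm inner_submxcol; congr (_ + _ * _).
by apply: eq_bigr => i _; rewrite sqr_enorm.
Qed.

Lemma Omega_ge0 (R : realType) (m n : nat) (N : 'I_m -> nat) (d : 'I_n -> nat)
    (lambda : R) (gamma : 'I_m -> R) (w : 'cV[R]_(\sum_k d k))
    (a : 'cV[R]_(\sum_i N i)) :
  0 < lambda -> (forall i, 0 < gamma i) -> 0 <= Omega lambda gamma w a.
Proof.
move=> l0 g0; rewrite addr_ge0// mulr_ge0 ?exprn_even_ge0 ?(ltW l0) ?invr_ge0//.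
by apply: sumr_ge0 => i _; rewrite mulr_ge0 ?exprn_even_ge0// ltW.
Qed.

(** * Expected decrease of the distance in one iteration *)

Section OneStep.
Variables (R : realType) (m n : nat) (N : 'I_m -> nat) (d : 'I_n -> nat).
Hypotheses (m_gt0 : (0 < m)%N) (n_gt0 : (0 < n)%N).
Variables (X : 'M[R]_(\sum_i N i, \sum_k d k))
  (f : forall i, 'cV[R]_(N i) -> R) (g : forall k, 'cV[R]_(d k) -> R)
  (lambda : R) (gamma : 'I_m -> R).
Hypotheses (lambda_gt0 : 0 < lambda) (gamma_gt0 : forall i, 0 < gamma i)
  (f_convex : forall i, convex_function setT (@f i))
  (f_diff : forall i x, differentiable (@f i) x)
  (f_smooth : forall i x y,
     enorm (gradient (@f i) x - gradient (@f i) y)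
       <= (gamma i)^-1 * enorm (x - y))
  (g_sconvex : strongly_convex lambda (separable_sum g)).
Variables (wstar : 'cV[R]_(\sum_k d k)) (astar : 'cV[R]_(\sum_i N i)).
Hypothesis saddle : saddle_point (lagrangian X f g) wstar astar.
Variables (p : 'I_m -> R) (q : 'I_n -> R).
Hypotheses (p_gt0 : forall i, 0 < p i) (p_sum : \sum_i p i = 1)
  (q_gt0 : forall k, 0 < q k) (q_sum : \sum_k q k = 1).
Variable (Gam : R).
Hypothesis (Gam_ge : forall i k, Num.max
     ((p i)^-1 * (1 + 9 * spectral_norm (submxblock X i k) ^+ 2
                      / (2 * q k * lambda * gamma i)))
     ((q k)^-1 * (1 + 9 * n%:R * spectral_norm (submxblock X i k) ^+ 2
                      / (2 * m%:R * p i * lambda * gamma i)))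
     <= Gam).
Hypotheses (pGam_gt1 : forall i, 1 < p i * Gam)
  (qGam_gt1 : forall k, 1 < q k * Gam).
Variables (sigma : 'I_m -> R) (tau : 'I_n -> R).
Hypotheses (sigmaE : forall i, sigma i = 1 / (2 * gamma i * (p i * Gam - 1)))
  (tauE : forall k, tau k = 1 / (2 * lambda * (q k * Gam - 1))).

Let sigma_gt0 i : 0 < sigma i.
Proof.
by rewrite sigmaE divr_gt0// mulr_gt0 ?subr_gt0// mulr_gt0.
Qed.

Let tau_gt0 k : 0 < tau k.
Proof.
by rewrite tauE divr_gt0// mulr_gt0 ?subr_gt0// mulr_gt0.
Qed.

(** The first bound on [Gam], rearranged so that each primal block is charged [lambda / 9]. *)
Let dual_rate i k : spectral_norm (submxblock X i k) ^+ 2 / q k <=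
  2 * gamma i * (p i * Gam - 1) * (lambda / 9).
Proof.
have := Gam_ge i k; rewrite ge_max => /andP[+ _].
rewrite -(ler_pM2l (p_gt0 i)) mulVKf ?gt_eqF// -lerBrDl => H.
have c0 : 0 < 2 * lambda * gamma i / 9 by rewrite divr_gt0// !mulr_gt0.
rewrite -(ler_pM2l c0) in H.
have -> : 2 * gamma i * (p i * Gam - 1) * (lambda / 9) =
  2 * lambda * gamma i / 9 * (p i * Gam - 1) by ring.
apply: le_trans H; rewrite le_eqVlt; apply/orP; left; apply/eqP.
by field; rewrite !gt_eqF.
Qed.

(** The second bound on [Gam], rearranged likewise. The charge carries [1 / n] because it is later
    summed over all [n] primal blocks. *)
Let primal_rate i k : (m%:R^-1 * spectral_norm (submxblock X i k)) ^+ 2 / p i <=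
  2 * lambda * (q k * Gam - 1) * (gamma i / (9 * m%:R * n%:R)).
Proof.
have := Gam_ge i k; rewrite ge_max => /andP[_].
rewrite -(ler_pM2l (q_gt0 k)) mulVKf ?gt_eqF// -lerBrDl => H.
have m0 : 0 < m%:R :> R by rewrite ltr0n.
have n0 : 0 < n%:R :> R by rewrite ltr0n.
have c0 : 0 < 2 * lambda * (gamma i / (9 * m%:R * n%:R)).
  by rewrite mulr_gt0 ?divr_gt0 ?mulr_gt0.
rewrite -(ler_pM2l c0) in H.
have -> : 2 * lambda * (q k * Gam - 1) * (gamma i / (9 * m%:R * n%:R)) =
  2 * lambda * (gamma i / (9 * m%:R * n%:R)) * (q k * Gam - 1) by ring.
apply: le_trans H; rewrite le_eqVlt; apply/orP; left; apply/eqP.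
by field; rewrite !gt_eqF.
Qed.

Variables (zbar z : iterate (R := R) (N := N) (d := d)).
Let step j l := svrg_step X f g p q sigma tau zbar j l z.
Let x l := submxcol (z.1 - wstar) l.
Let xbar l := submxcol (zbar.1 - wstar) l.
Let y j := submxcol (z.2 - astar) j.
Let ybar j := submxcol (zbar.2 - astar) j.
Let x' j l := submxcol ((step j l).1 - wstar) l.
Let y' j l := submxcol ((step j l).2 - astar) j.

Let Omega_step j l :
  Omega lambda gamma ((step j l).1 - wstar) ((step j l).2 - astar) =
  Omega lambda gamma (z.1 - wstar) (z.2 - astar)
  + (lambda * (inner (x' j l) (x' j l) - inner (x l) (x l)) +
     m%:R^-1 * (gamma j * (inner (y' j l) (y' j l) - inner (y j) (y j)))).
Proof.
rewrite !OmegaE (@big_change_one _ _ _ (fun k => inner (x k) (x k)) l); last first.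
  move=> k kl; rewrite /step /svrg_step /x; case: zbar z => [wb ab] [w a] /=.
  by rewrite !submxcolB mxcolK (negbTE kl).
rewrite (@big_change_one _ _ _ (fun i => gamma i * inner (y i) (y i)) j); last first.
  move=> i ij; rewrite /step /svrg_step /y; case: zbar z => [wb ab] [w a] /=.
  by rewrite !submxcolB mxcolK (negbTE ij).
rewrite -/(x' j l) -/(y' j l) -/(x _) -/(y _); ring.
Qed.

Let dual_block j :
  gamma j * (p j * Gam) *
    (\sum_l q l * inner (y' j l) (y' j l) - inner (y j) (y j)) <=
  - gamma j * inner (y j) (y j) + inner (\sum_l submxblock X j l *m x l) (y j)
    + \sum_l (lambda / 9) * (inner (x l) (x l) + inner (xbar l) (xbar l)).
Proof.
apply: (half_step_decrease q_gt0 q_sum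
  (fun l z => enorm_mulmx_le (submxblock X j l) z)
  (gamma_gt0 j) (pGam_gt1 j) (sigmaE j) (dual_rate j)) => l.
have astarE := saddle_dual m_gt0 gamma_gt0 f_convex f_diff f_smooth saddle j.
rewrite /y' /step submxcolB; case E : (svrg_step _ _ _ _ _ _ _ _ _ _ _) => [w2 a2].
move: E; rewrite /svrg_step /y /svrg_direction /x /xbar.
case: zbar z => [wb ab] [w a] /= [_ <-]; rewrite mxcolK eqxx submxcolB.
(* The centred direction is the estimate [u] of the step minus [submxcol X j *m wstar], the point
   whose gradient is the dual solution. *)
have -> : \sum_i submxblock X j i *m submxcol (wb - wstar) i +
    (q l)^-1 *: (submxblock X j l *m
      (submxcol (w - wstar) l - submxcol (wb - wstar) l)) =
    submxcol (X *m wb) j + (q l)^-1 *: (submxblock X j l *m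
      (submxcol w l - submxcol wb l)) - submxcol X j *m wstar.
  rewrite -submxcolB opprB addrA subrK submxcolB -submxcol_mulmx.
  by rewrite mulmxBr submxcolB submxcol_mul addrAC.
exact: (conjugate_prox_contraction (gamma_gt0 j) (@f_convex j) (@f_diff j)
  (@f_smooth j) (sigma_gt0 j) astarE).
Qed.

Let primal_block l :
  lambda * (q l * Gam) *
    (\sum_j p j * inner (x' j l) (x' j l) - inner (x l) (x l)) <=
  - lambda * inner (x l) (x l) +
    inner (\sum_j (- m%:R^-1 *: (submxblock X j l)^T) *m y j) (x l) +
    \sum_j (gamma j / (9 * m%:R * n%:R)) *
      (inner (y j) (y j) + inner (ybar j) (ybar j)).
Proof.
have Yb j (z0 : 'cV[R]_(N j)) :
    enorm ((- m%:R^-1 *: (submxblock X j l)^T) *m z0) <=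
    m%:R^-1 * spectral_norm (submxblock X j l) * enorm z0.
  rewrite -scalemxAl enormZ normrN ger0_norm ?invr_ge0// -mulrA.
  by rewrite ler_wpM2l ?invr_ge0// enorm_trmx_mulmx_le.
apply: (half_step_decrease p_gt0 p_sum Yb lambda_gt0 (qGam_gt1 l) (tauE l)
  (fun j => primal_rate j l)) => j.
have gstar := saddle_primal m_gt0 gamma_gt0 f_convex f_diff f_smooth saddle.
rewrite /x' /step submxcolB; case E : (svrg_step _ _ _ _ _ _ _ _ _ _ _) => [w2 a2].
move: E; rewrite /svrg_step /y /ybar /svrg_direction /x.
case: zbar z => [wb ab] [w a] /= [<- _]; rewrite mxcolK eqxx submxcolB.
set v := (X in prox _ (_ - _ *: X)).
(* The minus signs arise because the primal update moves along [- v], while the contraction is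
   stated for an added direction. *)
have -> : \sum_i - m%:R^-1 *: (submxblock X i l)^T *m submxcol (ab - astar) i +
    (p j)^-1 *: (- m%:R^-1 *: (submxblock X j l)^T *m
      (submxcol (a - astar) j - submxcol (ab - astar) j)) =
    - v - submxcol (- (m%:R^-1 *: (X^T *m astar))) l.
  under [X in X + _ = _]eq_bigr do rewrite -scalemxAl.
  rewrite -scaler_sumr -submxcol_trmx_mulmx -scalemxAl /v.
  rewrite -submxcolB opprB addrA subrK submxcolB.
  rewrite -scalerN !submxcolZ mulmxBr submxcolB submxcolN.
  move: (submxcol _ l) (submxcol (X^T *m astar) l) (_^T *m (_ - _)) => u1 u2 u3.
  by apply/colP => r; rewrite !mxE; ring.
have := strong_prox_contraction (tau_gt0 l) (convex_block (k := l) g_sconvex.1)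
  (fun x y xi => @strongly_convex_block _ _ _ _ _ _ _ l x y xi g_sconvex gstar)
  (subdifferential_block (k := l) gstar).
by apply; rewrite scalerN.
Qed.

(** Primal block inequalities are summed, dual ones summed and divided by [m]. The coupling [C] then
    enters once with [1 / m] and once with [- 1 / m], and the charges add up to one ninth of the two
    values of [Omega]. *)
Lemma expected_step_decrease :
  Gam * (\sum_j \sum_l p j * q l *
    Omega lambda gamma ((step j l).1 - wstar) ((step j l).2 - astar)) <=
  (Gam - 8 / 9) * Omega lambda gamma (z.1 - wstar) (z.2 - astar)
  + 1 / 9 * Omega lambda gamma (zbar.1 - wstar) (zbar.2 - astar).
Proof.
pose A j := \sum_l q l * inner (y' j l) (y' j l) - inner (y j) (y j).
pose B l := \sum_j p j * inner (x' j l) (x' j l) - inner (x l) (x l).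
have -> : \sum_j \sum_l p j * q l *
    Omega lambda gamma ((step j l).1 - wstar) ((step j l).2 - astar) =
    Omega lambda gamma (z.1 - wstar) (z.2 - astar) +
    (lambda * (\sum_l q l * B l) + m%:R^-1 * \sum_j p j * gamma j * A j).
  rewrite (eq_bigr _ (fun j _ => eq_bigr _ (fun l _ =>
    congr1 ( *%R (p j * q l)) (Omega_step j l)))) /=.
  move: (Omega _ _ _ _) => O.
  under eq_bigr => j _ do under eq_bigr => l _ do
    rewrite mulrDr [p j * q l * (_ + _)]mulrDr.
  under eq_bigr => j _ do rewrite !big_split /=.
  rewrite !big_split /=; congr (_ + (_ + _)).
  - under eq_bigr => j _ do rewrite -mulr_suml -mulr_sumr q_sum mulr1.
    by rewrite -mulr_suml p_sum mul1r.
  - rewrite exchange_big mulr_sumr; apply: eq_bigr => l _.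
    rewrite /B -[X in _ - X]mul1r -p_sum mulr_suml -sumrB !mulr_sumr.
    by apply: eq_bigr => j _; ring.
  - rewrite mulr_sumr; apply: eq_bigr => j _.
    rewrite /A -[X in _ - X]mul1r -q_sum mulr_suml -sumrB !mulr_sumr.
    by apply: eq_bigr => l _; ring.
(* Dual block [j] changes with probability [p j], which together with [Gam] is the weight
   [p j * Gam] of its block inequality. *)
have HA : Gam * (\sum_j p j * gamma j * A j) <= \sum_j (
  - gamma j * inner (y j) (y j) + inner (\sum_l submxblock X j l *m x l) (y j)
    + \sum_l (lambda / 9) * (inner (x l) (x l) + inner (xbar l) (xbar l))).
  rewrite mulr_sumr; apply: ler_sum => j _.
  apply: le_trans (dual_block j); rewrite -/(A j) le_eqVlt; apply/orP; left.
  by apply/eqP; ring.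
have HB : Gam * (lambda * \sum_l q l * B l) <= \sum_l (
  - lambda * inner (x l) (x l) +
    inner (\sum_j (- m%:R^-1 *: (submxblock X j l)^T) *m y j) (x l) +
    \sum_j (gamma j / (9 * m%:R * n%:R)) *
      (inner (y j) (y j) + inner (ybar j) (ybar j))).
  rewrite !mulr_sumr; apply: ler_sum => l _.
  apply: le_trans (primal_block l); rewrite -/(B l) le_eqVlt; apply/orP; left.
  by apply/eqP; ring.
have m0 : m%:R != 0 :> R by rewrite pnatr_eq0 -lt0n.
have n0 : n%:R != 0 :> R by rewrite pnatr_eq0 -lt0n.
pose Sx := \sum_l inner (x l) (x l); pose Sxb := \sum_l inner (xbar l) (xbar l).
pose Sy := \sum_j gamma j * inner (y j) (y j).
pose Syb := \sum_j gamma j * inner (ybar j) (ybar j).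
pose C := inner (X *m (z.1 - wstar)) (z.2 - astar).
have EA : \sum_j (
  - gamma j * inner (y j) (y j) + inner (\sum_l submxblock X j l *m x l) (y j)
    + \sum_l (lambda / 9) * (inner (x l) (x l) + inner (xbar l) (xbar l))) =
    - Sy + C + m%:R * (lambda / 9 * (Sx + Sxb)).
  rewrite !big_split /=; congr (_ + _ + _).
  - by under eq_bigr do rewrite mulNr; rewrite sumrN.
  - rewrite /C inner_submxcol; apply: eq_bigr => j _.
    by rewrite submxcol_mulmx.
  - by rewrite sumr_const card_ord mulr_natl -mulr_sumr big_split.
have EB : \sum_l (
  - lambda * inner (x l) (x l) +
    inner (\sum_j (- m%:R^-1 *: (submxblock X j l)^T) *m y j) (x l) +
    \sum_j (gamma j / (9 * m%:R * n%:R)) *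
      (inner (y j) (y j) + inner (ybar j) (ybar j))) =
    - lambda * Sx - m%:R^-1 * C + (9 * m%:R)^-1 * (Sy + Syb).
  rewrite !big_split /=; congr (_ + _ + _).
  - by rewrite -mulr_sumr.
  - rewrite /C inner_mulmx innerC inner_submxcol -mulNr mulr_sumr.
    apply: eq_bigr => l _; under eq_bigr do rewrite -scalemxAl.
    by rewrite -scaler_sumr innerZl submxcol_trmx_mulmx.
  - rewrite sumr_const card_ord -[LHS]mulr_natl -big_split /= !mulr_sumr.
    by apply: eq_bigr => j _; field; apply/andP.
rewrite EA in HA; rewrite EB in HB.
rewrite !OmegaE -/Sx -/Sxb -/Sy -/Syb.
have {}HA : m%:R^-1 * (Gam * (\sum_j p j * gamma j * A j)) <=
    m%:R^-1 * (- Sy + C + m%:R * (lambda / 9 * (Sx + Sxb))).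
  by rewrite ler_wpM2l// invr_ge0.
have E1 : m%:R^-1 * (- Sy + C + m%:R * (lambda / 9 * (Sx + Sxb))) =
  - (m%:R^-1 * Sy) + m%:R^-1 * C + lambda / 9 * (Sx + Sxb) by field.
have E2 : (9 * m%:R)^-1 * (Sy + Syb) = m%:R^-1 * (Sy + Syb) / 9 by field.
rewrite E1 in HA; rewrite E2 in HB; lra.
Qed.

End OneStep.

(** * Random histories *)

Section Mean.
Context {R : realType} {A : finType} (pi : A -> R).
Hypotheses (pi_ge0 : forall a, 0 <= pi a) (pi_sum : \sum_a pi a = 1).

(* The newest of the [K] independent draws comes first in the list. *)
Fixpoint mean (K : nat) (H : seq A -> R) : R :=
  if K is K'.+1 then \sum_a pi a * mean K' (fun h => H (a :: h)) else H [::].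

Lemma le_mean K (H G : seq A -> R) :
  (forall h, size h = K -> H h <= G h) -> mean K H <= mean K G.
Proof.
elim: K H G => [|K IH] H G HG /=; first exact: HG.
apply: ler_sum => a _; rewrite ler_wpM2l//; apply: IH => h hK.
by apply: HG; rewrite /= hK.
Qed.

Lemma mean_sum {I : finType} (c : I -> R) (G : I -> seq A -> R) K :
  mean K (fun h => \sum_i c i * G i h) = \sum_i c i * mean K (G i).
Proof.
elim: K G => //= K IH G; under eq_bigr => a _ do rewrite IH mulr_sumr.
rewrite exchange_big; apply: eq_bigr => i _; rewrite mulr_sumr.
by apply: eq_bigr => a _; rewrite mulrCA.
Qed.

Lemma mean_affine K (c e : R) (H : seq A -> R) :
  mean K (fun h => c * H h + e) = c * mean K H + e.
Proof.
elim: K H => //= K IH H; under eq_bigr => a _ do rewrite IH mulrDr mulrCA.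
by rewrite big_split -mulr_sumr -mulr_suml pi_sum mul1r.
Qed.

(** Fubini: [h'] holds the newer draws at the front, so the inner mean is conditional on the past
    [h]. *)
Lemma mean_cat K1 K2 (H : seq A -> R) :
  mean (K1 + K2) H = mean K2 (fun h => mean K1 (fun h' => H (h' ++ h))).
Proof.
elim: K1 H => [//|K1 IH] H; rewrite addSn [LHS]/=.
under eq_bigr => a _ do rewrite IH.
by rewrite -mean_sum.
Qed.

(** The definition averages over the newest draw outermost; here it is innermost, given the past. *)
Lemma meanS K (H : seq A -> R) :
  mean K.+1 H = mean K (fun h => \sum_a pi a * H (a :: h)).
Proof. by rewrite -add1n mean_cat. Qed.

End Mean.

Section History.
Context {A : Type}.

Fixpoint history (Z : nat -> A) (K : nat) : seq A :=
  if K is K'.+1 then Z K' :: history Z K' else [::].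

Lemma size_history Z K : size (history Z K) = K.
Proof. by elim: K => //= K ->. Qed.

Lemma history_add Z K t :
  history Z (K + t) = history (fun r => Z (K + r)%N) t ++ history Z K.
Proof. by elim: t => [|t IH]; rewrite ?addn0// addnS /= IH. Qed.

End History.

(** * Expectations over the random picks as finite weighted means *)

Section PickHistory.
Context {disp : measure_display} {T : measurableType disp} {R : realType}.
Context (P : probability T R) {m n : nat} (p : 'I_m -> R) (q : 'I_n -> R).
Context (J : nat -> T -> 'I_m) (L : nat -> T -> 'I_n).
Hypothesis picks : independent_picks P p q J L.

Definition pick_weight (a : 'I_m * 'I_n) : R := p a.1 * q a.2.

Definition pick_history (K : nat) (x : T) : seq ('I_m * 'I_n) :=
  history (fun r => (J r x, L r x)) K.

Let F (i : nat + nat) : set (set T) :=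
  match i with
  | inl r => generated_events (J r)
  | inr r => generated_events (L r)
  end.
Let idx (i : nat + nat) : nat := match i with inl r => r | inr r => r end.

Let FJ r (j : 'I_m) : F (inl r) (J r @^-1` [set j]).
Proof. by exists [set j] => //; rewrite setTI. Qed.

Let FL r (l : 'I_n) : F (inr r) (L r @^-1` [set l]).
Proof. by exists [set l] => //; rewrite setTI. Qed.

Let F_measurable i B : F i B -> measurable B.
Proof. by case: picks => mJ mL _ _ _; case: i => r; [exact: mJ|exact: mL]. Qed.

Let D_measurable (D : seq (nat + nat)) A : (forall i, i \in D -> F i (A i)) ->
  measurable (\big[setI/setT]_(i <- D) A i).
Proof.
move=> FA; rewrite big_seq; apply: big_ind => [|? ?|i iD].
- exact: measurableT.
- exact: measurableI.
- exact: F_measurable (FA i iD).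
Qed.

(** Every [Y] is allowed because the newest pick takes finitely many values, over which the preimage
    splits. *)
Lemma measurable_pick_history K (Y : set (seq ('I_m * 'I_n))) :
  measurable (pick_history K @^-1` Y).
Proof.
elim: K Y => [|K IH] Y.
  have [Y0|Y0] := pselect (Y [::]).
    by rewrite (_ : _ @^-1` _ = setT)//; apply/seteqP; split.
  by rewrite (_ : _ @^-1` _ = set0)//; apply/seteqP; split.
rewrite (_ : _ @^-1` _ = \big[setU/set0]_(a : 'I_m * 'I_n)
  ((J K @^-1` [set a.1] `&` L K @^-1` [set a.2]) `&`
   pick_history K @^-1` [set h | Y (a :: h)])).
  apply: bigsetU_measurable => a _; apply: measurableI; last exact: IH.
  apply: measurableI; first exact: F_measurable (FJ _ _).
  exact: F_measurable (FL _ _).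
rewrite -bigcup_seq; apply/seteqP; split=> [x Yx|x [[j l] _ [[/= <- <-]]]//].
by exists (J K x, L K x) => //=; rewrite mem_index_enum.
Qed.

Lemma measurable_fun_pick_history K (H : seq ('I_m * 'I_n) -> R) :
  measurable_fun setT ((fun x => (H (pick_history K x))%:E) : T -> \bar R).
Proof.
move=> _ Y _; rewrite setTI.
exact: (measurable_pick_history K [set h | Y (H h)%:E]).
Qed.

(* The events in [D] concern later picks only: an induction on [K] moves the
   newest pick from the history into the event. *)
Let integral_pick_history K (H : seq ('I_m * 'I_n) -> R)
    (D : seq (nat + nat)) (A : nat + nat -> set T) :
  (forall h, 0 <= H h) -> uniq D ->
  (forall i, i \in D -> (K <= idx i)%N) -> (forall i, i \in D -> F i (A i)) ->
  (\int[P]_(x in \big[setI/setT]_(i <- D) A i) (H (pick_history K x))%:E =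
   P (\big[setI/setT]_(i <- D) A i) * (mean pick_weight K H)%:E)%E.
Proof.
case: picks => _ _ PJ PL indep.
elim: K H D A => [|K IH] H D A H0 uD KD FA.
  by rewrite muleC -integral_cst//; exact: D_measurable.
set B := \big[setI/setT]_(i <- D) A i.
pose E (a : 'I_m * 'I_n) := J K @^-1` [set a.1] `&` (L K @^-1` [set a.2] `&` B).
have mB : measurable B by exact: D_measurable.
(* The picks of round [K] join the event. They are new to [D], whose indices all exceed [K]. *)
pose D' := [:: inl K, inr K & D] : seq (nat + nat).
pose A' a i := if i == inl K then J K @^-1` [set a.1] else
  if i == inr K then L K @^-1` [set a.2] else A i.
have KnD : (inl K \notin D) && (inr K \notin D).
  by apply/andP; split; apply/negP => /KD; rewrite /= ltnn.
have [KD1 KD2] := andP KnD.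
have A'E a i : i \in D -> A' a i = A i.
  rewrite /A' => iD; case: eqP => [iE|_]; first by rewrite iE (negbTE KD1) in iD.
  by case: eqP => [iE|//]; rewrite iE (negbTE KD2) in iD.
have AE a : \big[setI/setT]_(i <- D) A' a i = B.
  by apply: eq_big_seq => i iD; exact: A'E.
have EE a : E a = \big[setI/setT]_(i <- D') A' a i.
  by rewrite /D' !big_cons AE /A' !eqxx.
have uD' : uniq D' by rewrite /= inE uD KD1 KD2.
have FA' a i : i \in D' -> F i (A' a i).
  rewrite !inE /A'; case: eqP => [-> _|_]; first exact: FJ.
  by case: eqP => [-> _|_ /= /FA].
have KD' i : i \in D' -> (K <= idx i)%N.
  by rewrite !inE => /orP[/eqP->//|/orP[/eqP->//|/KD/ltnW]].
have mE a : measurable (E a) by rewrite EE; apply: D_measurable; exact: FA'.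
have PE a : P (E a) = ((pick_weight a)%:E * P B)%E.
  rewrite EE indep ?uD'//; last exact: FA'.
  rewrite !big_cons {1 2}/A' !eqxx /= PJ PL muleA -EFinM; congr (_ * _)%E.
  by rewrite /B indep//; apply: eq_big_seq => i iD; rewrite A'E.
have BE : B = \big[setU/set0]_(a <- index_enum ('I_m * 'I_n)%type) E a.
  rewrite -bigcup_seq; apply/seteqP; split=> [x Bx|x [a _ []] _ []//].
  by exists (J K x, L K x) => //=; rewrite mem_index_enum.
have step a : (\int[P]_(x in E a) (H (pick_history K.+1 x))%:E =
    (pick_weight a)%:E * P B * (mean pick_weight K (fun h => H (a :: h)))%:E)%E.
  rewrite -PE {2}EE -IH//; last exact: FA'.
  rewrite -EE; apply: eq_integral => x; rewrite inE => -[/= Jx [Lx _]].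
  by case: a Jx Lx => j l /= <- <-.
(* The event is cut along the values of round [K]; on each piece the newest entry of the history is
   constant. *)
rewrite {1}BE ge0_integral_bigsetU//=.
- rewrite (eq_bigr _ (fun a _ => step a)).
  have -> : P B = (fine (P B))%:E by rewrite fineK// fin_num_measure.
  under eq_bigr do rewrite -!EFinM.
  rewrite sumEFin -EFinM mulr_sumr; congr _%:E.
  by apply: eq_bigr => a _; ring.
- exact: index_enum_uniq.
- move=> [j l] [j' l'] _ _ [x [[/= <- [<- _]]]].
  by move=> [/= <- [<- _]].
- by apply: measurable_funTS; exact: measurable_fun_pick_history.
- by move=> x _; rewrite lee_fin.
Qed.

Lemma expectation_pick_history K (H : seq ('I_m * 'I_n) -> R) :
  (forall h, 0 <= H h) ->
  ('E_P[fun x => H (pick_history K x)] = (mean pick_weight K H)%:E)%E.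
Proof.
move=> H0; rewrite unlock.
have := @integral_pick_history K H [::] (fun=> setT) H0 isT.
by rewrite big_nil probability_setT mul1e; apply.
Qed.

End PickHistory.

(** * Stages *)

Lemma svrg_inner_history (R : realType) (m n : nat) (N : 'I_m -> nat)
    (d : 'I_n -> nat) (X : 'M[R]_(\sum_i N i, \sum_k d k))
    (f : forall i, 'cV[R]_(N i) -> R) (g : forall k, 'cV[R]_(d k) -> R)
    (p : 'I_m -> R) (q : 'I_n -> R) (sigma : 'I_m -> R) (tau : 'I_n -> R)
    zbar (Z : nat -> 'I_m * 'I_n) t :
  svrg_inner X f g p q sigma tau zbar (fun r => (Z r).1) (fun r => (Z r).2) t =
  foldr (fun a => svrg_step X f g p q sigma tau zbar a.1 a.2) zbar (history Z t).
Proof. by elim: t => //= t ->. Qed.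

Lemma stage_contraction (R : realType) (Gam : R) (M : nat) :
  1 < Gam -> ln 3 * Gam <= M%:R ->
  (1 - 8 / 9 / Gam) ^+ M * (7 / 8) + 1 / 8 <= 2 / 3.
Proof.
move=> G1 GM; have G0 : 0 < Gam by lra.
have rho0 : 0 <= 1 - 8 / 9 / Gam.
  by rewrite subr_ge0 ler_pdivrMr// mul1r; lra.
(* [r] is the inverse square root of 3. Weakening the exponent from [8 / 9] to [1 / 2] leaves a
   number with square exactly [1 / 3], enough for the final bound. *)
pose r : R := expR (- (ln 3 / 2)).
have r0 : 0 < r by exact: expR_gt0.
have r2 : r * r = 1 / 3.
  rewrite /r -expRD (_ : - (ln 3 / 2) + - (ln 3 / 2) = - ln 3 :> R); last by field.
  by rewrite expRN lnK ?posrE// div1r.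
have ln3 : 0 <= ln 3 :> R by rewrite ln_ge0//; lra.
suff H : (1 - 8 / 9 / Gam) ^+ M <= r by nra.
have H1 : 1 - 8 / 9 / Gam <= expR (- (8 / 9 / Gam)) by exact: expR_ge1Dx.
apply: (@le_trans _ _ (expR (- (8 / 9 / Gam)) ^+ M)).
  by apply: lerXn2r => //; rewrite nnegrE ?expR_ge0.
rewrite -expRM_natl ler_expR mulrN lerN2.
have H2 : ln 3 <= M%:R / Gam by rewrite ler_pdivlMr.
have -> : M%:R * (8 / 9 / Gam) = 8 / 9 * (M%:R / Gam) by ring.
lra.
Qed.

Theorem theorem1 (R : realType) (m n : nat) (N : 'I_m -> nat) (d : 'I_n -> nat)
  (m_gt0 : (0 < m)%N) (n_gt0 : (0 < n)%N)
  (N_gt0 : forall i, (0 < N i)%N) (d_gt0 : forall k, (0 < d k)%N)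
  (X : 'M[R]_(\sum_i N i, \sum_k d k))
  (f : forall i, 'cV[R]_(N i) -> R) (g : forall k, 'cV[R]_(d k) -> R)
  (lambda : R) (gamma : 'I_m -> R)
  (lambda_gt0 : 0 < lambda) (gamma_gt0 : forall i, 0 < gamma i)
  (f_convex : forall i, convex_function setT (f i))
  (f_diff : forall i x, differentiable (f i) x)
  (f_smooth : forall i x y,
     enorm (gradient (f i) x - gradient (f i) y)
       <= (gamma i)^-1 * enorm (x - y))
  (g_sconvex : strongly_convex lambda (separable_sum g))
  (wstar : 'cV[R]_(\sum_k d k)) (astar : 'cV[R]_(\sum_i N i))
  (saddle : saddle_point (lagrangian X f g) wstar astar)
  (p : 'I_m -> R) (q : 'I_n -> R)
  (p_gt0 : forall i, 0 < p i) (p_sum : \sum_i p i = 1)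
  (q_gt0 : forall k, 0 < q k) (q_sum : \sum_k q k = 1)
  (Gam : R)
  (Gam_ge : forall i k, Num.max
     ((p i)^-1 * (1 + 9 * spectral_norm (submxblock X i k) ^+ 2
                      / (2 * q k * lambda * gamma i)))
     ((q k)^-1 * (1 + 9 * n%:R * spectral_norm (submxblock X i k) ^+ 2
                      / (2 * m%:R * p i * lambda * gamma i)))
     <= Gam)
  (pGam_gt1 : forall i, 1 < p i * Gam) (qGam_gt1 : forall k, 1 < q k * Gam)
  (sigma : 'I_m -> R) (tau : 'I_n -> R)
  (sigmaE : forall i, sigma i = 1 / (2 * gamma i * (p i * Gam - 1)))
  (tauE : forall k, tau k = 1 / (2 * lambda * (q k * Gam - 1)))
  (M : nat) (M_gt0 : (0 < M)%N) (M_ge : ln 3 * Gam <= M%:R)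
  (w0 : 'cV[R]_(\sum_k d k)) (a0 : 'cV[R]_(\sum_i N i))
  (disp : measure_display) (T : measurableType disp) (P : probability T R)
  (J : nat -> T -> 'I_m) (L : nat -> T -> 'I_n)
  (picks : independent_picks P p q J L)
  (s : nat) (s_gt0 : (0 < s)%N) :
  let zbar (x : T) :=
    dscovr_svrg X f g p q sigma tau M (w0, a0)
      (fun r => J r x) (fun r => L r x) s in
  ('E_P[fun x => Omega lambda gamma ((zbar x).1 - wstar) ((zbar x).2 - astar)]
   <= ((2 / 3) ^+ s * Omega lambda gamma (w0 - wstar) (a0 - astar))%:E)%E.
Proof.
cbv zeta.
pose pi := @pick_weight R m n p q.
have pi0 a : 0 <= pi a by rewrite mulr_ge0 ?ltW.
have pi1 : \sum_a pi a = 1.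
  rewrite -(pair_bigA _ (fun j l => p j * q l)) /=.
  by under eq_bigr do rewrite -mulr_sumr q_sum mulr1.
have G1 : 1 < Gam.
  pose j0 := Ordinal m_gt0.
  have pj1 : p j0 <= 1.
    by rewrite -p_sum (bigD1 j0)//= lerDl sumr_ge0// => i _; rewrite ltW.
  have := pGam_gt1 j0; have := p_gt0 j0; nra.
have G0 : 0 < Gam by lra.
pose Om (z : iterate) := Omega lambda gamma (z.1 - wstar) (z.2 - astar).
have Om0 z : 0 <= Om z by exact: Omega_ge0.
pose step zb (a : 'I_m * 'I_n) := svrg_step X f g p q sigma tau zb a.1 a.2.
have one zb z : \sum_a pi a * Om (step zb a z) <=
    (1 - 8 / 9 / Gam) * Om z + 1 / 9 / Gam * Om zb.
  have := expected_step_decrease m_gt0 n_gt0 lambda_gt0 gamma_gt0 f_convex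
    f_diff f_smooth g_sconvex saddle p_gt0 p_sum q_gt0 q_sum Gam_ge pGam_gt1
    qGam_gt1 sigmaE tauE zb z.
  rewrite (pair_bigA _ (fun j l => p j * q l * Omega lambda gamma
    ((svrg_step X f g p q sigma tau zb j l z).1 - wstar)
    ((svrg_step X f g p q sigma tau zb j l z).2 - astar))) -/(Om _) -/(Om _) => H.
  rewrite -(ler_pM2l G0); apply: le_trans H _.
  rewrite le_eqVlt; apply/orP; left; apply/eqP; field; lra.
(* The recursion with rate [1 - 8 / 9 / Gam] and source [1 / 9 / Gam] has fixed point [1 / 8]; the
   start value 1 exceeds it by [7 / 8]. *)
have inner zb t : mean pi t (fun h => Om (foldr (step zb) zb h)) <=
    ((1 - 8 / 9 / Gam) ^+ t * (7 / 8) + 1 / 8) * Om zb.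
  elim: t => [|t IH]; first by rewrite /= expr0; have := Om0 zb; lra.
  rewrite meanS; apply: le_trans (le_mean pi0 (fun h _ => one zb _)) _.
  rewrite mean_affine//.
  have rho0 : 0 <= 1 - 8 / 9 / Gam.
    by rewrite subr_ge0 ler_pdivrMr// mul1r; lra.
  apply: le_trans (lerD (ler_wpM2l rho0 IH) (lexx _)) _.
  rewrite exprS le_eqVlt; apply/orP; left; apply/eqP; field; lra.
(* The stage iterate is a deterministic function [F] of the picks so far, so the stages can be
   chained by conditioning inside [mean]. *)
have stages : exists2 F : seq ('I_m * 'I_n) -> iterate,
    forall Z, dscovr_svrg X f g p q sigma tau M (w0, a0) (fun r => (Z r).1)
      (fun r => (Z r).2) s = F (history Z (s * M)) &
    mean pi (s * M) (Om \o F) <= (2 / 3) ^+ s * Om (w0, a0).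
  elim: s {s_gt0} => [|s [F FE Fle]].
    by exists (fun=> (w0, a0)) => //=; rewrite mul1r.
  (* The newest [M] picks, at the front, drive the current stage; the rest determine its reference
     point. *)
  exists (fun h => foldr (step (F (drop M h))) (F (drop M h)) (take M h)).
    move=> Z; rewrite /= FE mulSnr history_add.
    rewrite take_size_cat ?size_history// drop_size_cat ?size_history//.
    exact: svrg_inner_history.
  rewrite mulSn mean_cat exprS -mulrA.
  apply: le_trans (ler_wpM2l _ Fle); last by lra.
  rewrite -[leRHS]addr0 -mean_affine//; apply: le_mean => // h _.
  rewrite addr0; apply: (@le_trans _ _
    (mean pi M (fun h' => Om (foldr (step (F h)) (F h) h')))).
    by apply: le_mean => // h' hM /=; rewrite take_size_cat// drop_size_cat.
  apply: le_trans (inner _ _) _; rewrite ler_wpM2r//.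
  exact: stage_contraction.
have [F FE Fle] := stages.
have := expectation_pick_history picks (s * M) (H := Om \o F) (fun h => Om0 _).
rewrite -lee_fin in Fle; move: Fle => /[swap] <-.
by congr (_ <= _)%E; congr ('E_P[_])%E; apply/funext => x; rewrite /= -FE.
Qed.
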